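(* Given a database instance $D$, we can enumerate the output of $Q_{\texttt{two-path}} = \pi_{x,z} (R(x,y) \Join S(y,z))$ with preprocessing time $O(|D|)$ and delay $O(|D|^2/ |\mathrm{OUT}_{\Join}|)$.
   Context: Here $\mathrm{OUT}_{\Join}$ denotes the output of the corresponding full join query without projection, $R(x,y) \Join S(y,z)$, and $|\mathrm{OUT}_{\Join}|$ is its size. Enumeration is split into a preprocessing phase (building a data structure in preprocessing time) and an enumeration phase, where the delay is the maximum time between outputting consecutive tuples (including time to the first tuple and to signal completion), with no repeated outputs. Complexity is measured in data complexity in the uniform-cost RAM model. *)

(* Defs.v *)
From mathcomp Require Import all_boot.
Set Implicit Arguments. Unset Strict Implicit. Unset Printing Implicit Defensive.

(* Memory: an unbounded array of natural-number cells (initially 0 outside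
   the input), with direct and indirect addressing; every instruction costs 1. *)
Inductive instr :=
| IConst of nat & nat
| IAdd   of nat & nat & nat
| ISub   of nat & nat & nat
| ILt    of nat & nat & nat
| ILoad  of nat & nat
| IStore of nat & nat
| IJz    of nat & nat
| IJmp   of nat
| IOut   of nat & nat
| IEndPre
| IHalt.

Definition program := seq instr.
Definition config := (nat * (nat -> nat))%type.

Definition upd (m : nat -> nat) (a v : nat) : nat -> nat :=
  fun x => if x == a then v else m x.

Definition cur_instr (P : program) (cf : config) : instr := nth IHalt P cf.1.

Definition step (P : program) (cf : config) : config :=
  let: (pc, m) := cf in
  match nth IHalt P pc with
  | IConst a n => (pc.+1, upd m a n)
  | IAdd a b c => (pc.+1, upd m a (m b + m c))
  | ISub a b c => (pc.+1, upd m a (m b - m c))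
  | ILt a b c => (pc.+1, upd m a (nat_of_bool (m b < m c)))
  | ILoad a b => (pc.+1, upd m a (m (m b)))
  | IStore a b => (pc.+1, upd m (m a) (m b))
  | IJz a l => (if m a == 0 then l else pc.+1, m)
  | IJmp l => (l, m)
  | IOut _ _ => (pc.+1, m)
  | IEndPre => (pc.+1, m)
  | IHalt => (pc, m)
  end.

Definition conf_at (P : program) (init : config) (t : nat) : config :=
  iter t (step P) init.

Definition is_halt (i : instr) : bool := if i is IHalt then true else false.
Definition is_endpre (i : instr) : bool := if i is IEndPre then true else false.

Definition out_at (P : program) (init : config) (t : nat) : option (nat * nat) :=
  let cf := conf_at P init t in
  if cur_instr P cf is IOut a b then Some (cf.2 a, cf.2 b) else None.

Definition halted_at (P : program) (init : config) (t : nat) : bool :=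
  is_halt (cur_instr P (conf_at P init t)).

Definition endpre_at (P : program) (init : config) (t : nat) : bool :=
  is_endpre (cur_instr P (conf_at P init t)).

(* A relation is a duplicate-free list of binary tuples over the domain nat. *)
Definition relation := seq (nat * nat).

Definition db_size (R S : relation) : nat := size R + size S.

Definition enc_flat (R S : relation) : seq nat :=
  [:: size R, size S & flatten [seq [:: t.1; t.2] | t <- R ++ S]].

Definition init_config (R S : relation) : config :=
  (0, fun a => nth 0 (enc_flat R S) a).

Definition full_join (R S : relation) : seq (nat * nat * nat) :=
  undup [seq (r.1, r.2, s.2) | r <- R, s <- [seq s <- S | s.1 == r.2]].

Definition two_path (R S : relation) : seq (nat * nat) :=
  undup [seq (r.1, s.2) | r <- R, s <- [seq s <- S | s.1 == r.2]].

(* P enumerates the answer set [ans] on input (R,S) with preprocessing time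
   at most [pre] and delay at most [delay]:
   - the preprocessing phase ends at step tp <= pre (first IEndPre executed),
     with no output before it;
   - the machine halts at some step T >= tp;
   - the tuples output during [tp, T) are exactly [ans], without repetition;
   - after tp, every window of [delay] steps contains an output or the halt
     (this bounds the time to the first tuple, between consecutive tuples,
     and to signal completion). *)
Definition enumerates (P : program) (R S : relation) (ans : seq (nat * nat))
    (pre delay : nat) : Prop :=
  let init := init_config R S in
  exists tp T,
    [/\ tp <= pre /\ endpre_at P init tp,
        (forall t, t < tp -> ~~ endpre_at P init t /\ out_at P init t = None),
        [/\ tp <= T, halted_at P init T & (forall t, t < T -> ~~ halted_at P init t)],
        (let outs := pmap (out_at P init) (iota tp (T - tp)) in
           uniq outs /\ perm_eq outs ans)
      & (forall t, tp <= t <= T -> exists t', t <= t' <= t + delay /\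
            ((t' == T) || (out_at P init t' != None)))].

(* Main.v *)
Require Import Defs.
From mathcomp Require Import all_boot.
From mathcomp Require Import zify.

(** Write a_y, b_y for the degrees of a join value y in R and S, N = |D| and
    J = sum_y a_y b_y = |OUT_join|. Choose y* maximising p = a_y b_y; its p output
    pairs are pairwise distinct and can be written at any time, without any search.
    By Cauchy-Schwarz and sqrt(a_y b_y) <= a_y + b_y, J^2 <= N^2 p. The enumeration
    walks over all join triples, writing each new pair (x, z) that does not come
    from y* (duplicates are detected with a table indexed by row(x) + z, which costs
    nothing to initialise because memory is zero). A walk of about N + J units
    that writes one pair of y* every 4 N^2 / (J + 1) units writes at most p of them,
    so this reserve never runs out and bounds the delay; what is left of it is
    written at the end. An accumulator increased by J + 1 per unit and compared with
    4 N^2 replaces the division, which the machine could not afford. *)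

Set Implicit Arguments. Unset Strict Implicit. Unset Printing Implicit Defensive.

(** The obstacle is repetition: one pair (x, z) may come from many join values, so the walk can run
    for long without meeting a new pair. The pairs of y* fill such stretches, and excluding them
    from the walk, by one membership bit for x and one for z, lets them be written at any moment
    without a check. Besides J^2 <= N^2 p, two cruder bounds enter: J <= N p absorbs the lower-order
    terms of (N + J)(J + 1), and J <= N^2 keeps the increment J + 1 within the threshold, so that
    one subtraction per emission is enough. The machine neither multiplies nor divides, so J, the
    products a_y b_y, the row offsets and 4 N^2 are all sums accumulated while the tuples are
    scanned. Programs are written in a small structured language whose compilation preserves the
    trace step by step; delays are then proved on traces, without program counters. *)

(* Abstract memory of the structured programs: register [r] is cell [r] (with
   [r < 32]) and entry [v] of array [j < 16] is cell [B + 16 * v + j], where [B]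
   is kept in cell 1; cell 2 is scratch space for address computations. *)
Record state := State { rg : nat -> nat; ar : nat -> nat -> nat }.

(** * Structured programs and their compilation to machine code *)

Inductive op :=
| OConst of nat & nat
| OAdd of nat & nat & nat
| OSub of nat & nat & nat
| OLt of nat & nat & nat
| OLoad of nat & nat & nat
| OStore of nat & nat & nat
| OOut of nat & nat.

(** [Raw] loads from an absolute address. It serves to copy the input, which is not laid out like
    the interleaved arrays. *)
Inductive cmd :=
| Blk of seq op
| Raw of nat & nat
| Seq of cmd & cmd
| If of nat & cmd & cmd
| While of nat & cmd.

(** One entry per machine step, so that lengths of traces are running times and delays can be read
    off them. *)
Definition trace := seq (option (nat * nat)).

Definition upda (f : nat -> nat -> nat) j v x :=
  fun j' => if j' == j then upd (f j) v x else f j'.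

Definition sem1 (s : state) (o : op) : state :=
  let: State g f := s in
  match o with
  | OConst r n => State (upd g r n) f
  | OAdd r a b => State (upd g r (g a + g b)) f
  | OSub r a b => State (upd g r (g a - g b)) f
  | OLt r a b => State (upd g r (nat_of_bool (g a < g b))) f
  | OLoad r j v => State (upd g r (f j (g v))) f
  | OStore j v r => State g (upda f j (g v) (g r))
  | OOut _ _ => s
  end.

(* Computes in cell 2 the address of entry [v] of array [j]; the lock keeps
   the sixteen additions from being unfolded in proofs. *)
Fact addr_key : unit. Proof. by []. Qed.
Definition addr j v : seq instr := locked_with addr_key
  (IConst 2 j :: nseq 16 (IAdd 2 2 v) ++ [:: IAdd 2 2 1]).

Definition code1 (o : op) : seq instr :=
  match o with
  | OConst r n => [:: IConst r n]
  | OAdd r a b => [:: IAdd r a b]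
  | OSub r a b => [:: ISub r a b]
  | OLt r a b => [:: ILt r a b]
  | OLoad r j v => rcons (addr j v) (ILoad r 2)
  | OStore j v r => rcons (addr j v) (IStore 2 r)
  | OOut a b => [:: IOut a b]
  end.

Definition tr1 (s : state) (o : op) : trace :=
  if o is OOut a b then [:: Some (rg s a, rg s b)] else nseq (size (code1 o)) None.

Fixpoint sem (s : state) (l : seq op) : state :=
  if l is o :: l' then sem (sem1 s o) l' else s.

Fixpoint tr (s : state) (l : seq op) : trace :=
  if l is o :: l' then tr1 s o ++ tr (sem1 s o) l' else [::].

Fixpoint clen (c : cmd) : nat :=
  match c with
  | Blk l => size (flatten (map code1 l))
  | Raw _ _ => 1
  | Seq c1 c2 => clen c1 + clen c2
  | If _ c1 c2 => clen c1 + clen c2 + 2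
  | While _ c => clen c + 2
  end.

(** Jump targets of the machine are absolute, hence the load address [k]. *)
Fixpoint compile (k : nat) (c : cmd) : seq instr :=
  match c with
  | Blk l => flatten (map code1 l)
  | Raw r v => [:: ILoad r v]
  | Seq c1 c2 => compile k c1 ++ compile (k + clen c1) c2
  | If r c1 c2 =>
      IJz r (k + clen c1 + 2) :: compile k.+1 c1 ++
      IJmp (k + clen c1 + 2 + clen c2) :: compile (k + clen c1 + 2) c2
  | While r c => IJz r (k + clen c + 2) :: compile k.+1 c ++ [:: IJmp k]
  end.

Lemma size_compile k c : size (compile k c) = clen c.
Proof.
elim: c k => //= [c1 IH1 c2 IH2|r c1 IH1 c2 IH2|r c IH] k.
- by rewrite size_cat IH1 IH2.
- by rewrite size_cat /= IH1 IH2; lia.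
- by rewrite size_cat /= IH; lia.
Qed.

(** Programs may read cells 0 and 1, which will hold |D| and [B], but write neither; the scratch
    cell 2 is reserved for compiled address computations. *)
Definition wfr r := (2 < r < 32).
Definition wfs r := (r < 32) && (r != 2).
Definition wf1 (o : op) : bool :=
  match o with
  | OConst r _ => wfr r
  | OAdd r a b | OSub r a b | OLt r a b => [&& wfr r, wfs a & wfs b]
  | OLoad r j v => [&& wfr r, j < 16 & wfs v]
  | OStore j v r => [&& j < 16, wfs v & wfs r]
  | OOut a b => wfs a && wfs b
  end.

Fixpoint wf (c : cmd) : bool :=
  match c with
  | Blk l => all wf1 l
  | Raw r v => wfr r && wfs v
  | Seq c1 c2 => wf c1 && wf c2
  | If r c1 c2 => [&& wfs r, wf c1 & wf c2]
  | While r c => wfs r && wf c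
  end.

(** * Machine runs and correctness of the compilation *)

Definition obs (P : program) (cf : config) :=
  if cur_instr P cf is IOut a b then Some (cf.2 a, cf.2 b) else None.

(** Neither [IEndPre] nor [IHalt] is executed on the way, so a run stays within one phase. *)
Fixpoint runs (P : program) (cf : config) (t : trace) (cf' : config) : Prop :=
  if t is o :: t' then
    [/\ ~~ is_halt (cur_instr P cf), ~~ is_endpre (cur_instr P cf),
        obs P cf = o & runs P (step P cf) t' cf']
  else cf = cf'.

Lemma runs_cat P c1 c2 c3 t1 t2 :
  runs P c1 t1 c2 -> runs P c2 t2 c3 -> runs P c1 (t1 ++ t2) c3.
Proof. by elim: t1 c1 => [|o t1 IH] c1 /= => [->|[? ? ? H] ?] //; split=> //; apply: IH. Qed.

Fixpoint code_at (P : program) (k : nat) (l : seq instr) : Prop :=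
  if l is i :: l' then nth IHalt P k = i /\ code_at P k.+1 l' else True.

Lemma code_at_cat P k l1 l2 :
  code_at P k (l1 ++ l2) <-> code_at P k l1 /\ code_at P (k + size l1) l2.
Proof.
elim: l1 k => [|i l1 IH] k /=; first by rewrite addn0; tauto.
by rewrite IH addSnnS; tauto.
Qed.

Lemma code_at_mid p l q : code_at (p ++ l ++ q) (size p) l.
Proof.
elim: l p => //= i l IH p; split; first by rewrite nth_cat ltnn subnn.
by have := IH (rcons p i); rewrite size_rcons cat_rcons.
Qed.

Definition plain (i : instr) : bool :=
  match i with
  | IConst _ _ | IAdd _ _ _ | ISub _ _ _ | ILt _ _ _ | ILoad _ _ | IStore _ _ => true
  | _ => false
  end.

Definition mstep (m : nat -> nat) (i : instr) : nat -> nat :=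
  match i with
  | IConst a n => upd m a n
  | IAdd a b c => upd m a (m b + m c)
  | ISub a b c => upd m a (m b - m c)
  | ILt a b c => upd m a (nat_of_bool (m b < m c))
  | ILoad a b => upd m a (m (m b))
  | IStore a b => upd m (m a) (m b)
  | _ => m
  end.

Lemma runs_plain P k m l : code_at P k l -> all plain l ->
  runs P (k, m) (nseq (size l) None) (k + size l, foldl mstep m l).
Proof.
elim: l k m => [|i l IH] k m /=; first by rewrite addn0.
move=> [E H] /andP[pi pl]; rewrite /obs /cur_instr /= E.
have := IH _ (mstep m i) H pl; rewrite addSnnS.
by case: i pi {E} => //= *; split.
Qed.

Lemma add_loop m a b k : a != b ->
  foldl mstep m (nseq k (IAdd a a b)) =1 upd m a (m a + k * m b).
Proof.
rewrite eq_sym => /negbTE ba; elim: k m => [|k IH] m x /=; first by rewrite /upd; case: eqP => [->|]; lia.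
by rewrite IH /upd eqxx ba; case: ifP => [_|->] //; lia.
Qed.

Lemma addrP m j v : wfs v ->
  foldl mstep m (addr j v) =1 upd m 2 (m 1 + 16 * m v + j).
Proof.
rewrite /addr unlock; move: 16 => n /andP[_ v2] x /=.
rewrite foldl_cat /= !add_loop ?(eq_sym 2) //.
rewrite /upd /= (negbTE v2); case: ifP => x2; first lia.
by rewrite add_loop ?(eq_sym 2) // /upd /= x2.
Qed.

Lemma plain_code1 o : ~~ (if o is OOut _ _ then true else false) -> all plain (code1 o).
Proof.
have H j v : all plain (addr j v) by rewrite /addr unlock.
by case: o => //= *; rewrite all_rcons H.
Qed.

Section Execution.
(* [inp] is the part of the input, at the addresses in [32, lim[, which the
   machine has not yet moved. *)
Variables (inp : nat -> nat) (lim : nat).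

(** The extra [None] entries are the jumps of the compiled code: the conditional one in front, and
    the [IJmp] after a taken first branch or a loop body. *)
Inductive exec : cmd -> state -> state -> trace -> Prop :=
| EBlk l s : exec (Blk l) s (sem s l) (tr s l)
| ERaw r v s : 32 <= rg s v < lim ->
    exec (Raw r v) s (State (upd (rg s) r (inp (rg s v))) (ar s)) [:: None]
| ESeq c1 c2 s1 s2 s3 t1 t2 :
    exec c1 s1 s2 t1 -> exec c2 s2 s3 t2 -> exec (Seq c1 c2) s1 s3 (t1 ++ t2)
| EIf1 r c1 c2 s s' t : rg s r <> 0 -> exec c1 s s' t ->
    exec (If r c1 c2) s s' (None :: rcons t None)
| EIf0 r c1 c2 s s' t : rg s r = 0 -> exec c2 s s' t ->
    exec (If r c1 c2) s s' (None :: t)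
| EWhile0 r c s : rg s r = 0 -> exec (While r c) s s [:: None]
| EWhile1 r c s1 s2 s3 t1 t2 : rg s1 r <> 0 ->
    exec c s1 s2 t1 -> exec (While r c) s2 s3 t2 ->
    exec (While r c) s1 s3 (None :: rcons t1 None ++ t2).

(** With stride 16 all sixteen arrays are unbounded and never collide. The bounds on [m 1] keep them
    clear of the registers and of the input still to be moved. *)
Definition represents (s : state) (m : nat -> nat) : Prop :=
  [/\ 32 <= m 1, lim <= m 1, forall r, wfs r -> m r = rg s r,
      forall j v, j < 16 -> m (m 1 + 16 * v + j) = ar s j v
    & forall v, 32 <= v < lim -> m v = inp v].

Lemma represents_upd s m m' r x : wfr r -> represents s m -> m' =1 m \/ m' =1 upd m 2 (m' 2) ->
  represents (State (upd (rg s) r x) (ar s)) (upd m' r x).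
Proof.
move=> /andP[r2 r32] [h1 h2 h3 h4 h5] hm.
have E y : y != 2 -> m' y = m y.
  by move=> /negbTE y2; case: hm => [//|->]; rewrite /upd y2.
have E1 : upd m' r x 1 = m 1 by rewrite /upd E // ifN //; apply/eqP; lia.
split; rewrite ?E1 //.
- move=> y wy; rewrite /upd /=; case: ifP => // _; rewrite E ?h3 //.
  by case/andP: wy.
- move=> j v j16; rewrite /upd /= ifN ?E ?h4 //; apply/eqP; lia.
- by move=> v hv; rewrite /upd ifN ?E ?h5 //; apply/eqP; lia.
Qed.

Lemma represents_code1 s m o : wf1 o -> ~~ (if o is OOut _ _ then true else false) ->
  represents s m -> represents (sem1 s o) (foldl mstep m (code1 o)).
Proof.
case: s => g f; case: o => [r n|r a b|r a b|r a b|r j v|j v r|a b] w h H; last by [].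
all: rewrite /= in w *; clear h.
- by apply: (represents_upd n w H); left.
- case/and3P: w => w1 wa wb; have [_ _ E _ _] := H.
  by rewrite !E //; apply: (represents_upd _ w1 H); left.
- case/and3P: w => w1 wa wb; have [_ _ E _ _] := H.
  by rewrite !E //; apply: (represents_upd _ w1 H); left.
- case/and3P: w => w1 wa wb; have [_ _ E _ _] := H.
  by rewrite !E //; apply: (represents_upd _ w1 H); left.
- case/and3P: w => w1 wj wv; have [E0 _ E1 E2 _] := H.
  rewrite -cats1 foldl_cat /= !addrP // /upd /= ifN; last by apply/eqP; lia.
  rewrite E2 // E1 //; apply: (represents_upd _ w1 H); right => x.
  by rewrite !addrP // /upd /=.
- case/and3P: w => wj wv wr; have [E0 E0' E1 E2 E3] := H.
  rewrite -cats1 foldl_cat /=; set m' := foldl _ _ _.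
  have E x : m' x = upd m 2 (m 1 + 16 * m v + j) x by rewrite /m' addrP.
  have F x : x != 2 -> m' x = m x by move=> /negbTE x2; rewrite E /upd x2.
  have -> : m' r = g r by rewrite F ?E1 //; case/andP: wr.
  have -> : m' 2 = m 1 + 16 * g v + j by rewrite E /upd /= (E1 v).
  have G x : x < 32 -> x != 2 -> upd m' (m 1 + 16 * g v + j) (g r) x = m x.
    by move=> x1 x2; rewrite /upd ifN ?F //; apply/eqP; lia.
  split; rewrite ?G //.
  + by move=> x /[dup] /andP[? ?] ?; rewrite G ?E1.
  + move=> j' v' j'16; rewrite /upd /upda /=.
    have [->|nj] := eqVneq j' j.
      rewrite /upd; have [->|nv] := eqVneq v' (g v); first by rewrite eqxx.
      by move/eqP: nv => nv; rewrite ifN ?F ?E2 //; apply/eqP; lia.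
    by move/eqP: nj => nj; rewrite ifN ?F ?E2 //; apply/eqP; lia.
  + move=> x hx; have [x2 xn] : x != 2 /\ x != m 1 + 16 * g v + j.
      by case/andP: hx => hx1 hx2; split; apply/eqP; lia.
    by rewrite /upd (negbTE xn) F ?E3.
Qed.

Lemma runs_op P k s m o : wf1 o -> represents s m -> code_at P k (code1 o) ->
  exists2 m', runs P (k, m) (tr1 s o) (k + size (code1 o), m') & represents (sem1 s o) m'.
Proof.
move=> w H E; case: (boolP (if o is OOut _ _ then true else false)) => oo.
  case: o w oo E => // a b /andP[wa wb] _ /= [E _]; exists m; last by case: s H.
  have [_ _ E1 _ _] := H.
  by rewrite /obs /cur_instr /= E !E1 //= addn1; split.
exists (foldl mstep m (code1 o)); last exact: represents_code1.
have -> : tr1 s o = nseq (size (code1 o)) None by case: o oo {w E}.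
by apply: runs_plain => //; apply: plain_code1.
Qed.

Lemma runs_exec P c s s' t : exec c s s' t -> wf c ->
  forall k m, represents s m -> code_at P k (compile k c) ->
  exists2 m', runs P (k, m) t (k + clen c, m') & represents s' m'.
Proof.
elim=> {c s s' t} /=.
- elim=> [|o l IH] s /=; first by move=> _ k m H _; exists m; rewrite ?addn0.
  move=> /andP[w1 w2] k m H /code_at_cat[E1 E2].
  have [m1 R1 H1] := runs_op w1 H E1.
  have [m2 R2 H2] := IH _ w2 _ _ H1 E2.
  by exists m2 => //; rewrite size_cat addnA; apply: runs_cat R1 R2.
- move=> r v s hv /andP[wr wv] k m H [E _].
  have [_ _ E1 _ E3] := H.
  exists (upd m r (inp (rg s v))); last by apply: (represents_upd _ wr H); left.
  by rewrite /obs /cur_instr /= E; split; rewrite ?(E1 v) ?E3 ?addn1.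
- move=> c1 c2 s1 s2 s3 t1 t2 _ IH1 _ IH2 /andP[w1 w2] k m H /code_at_cat[E1 E2].
  have [m1 R1 H1] := IH1 w1 _ _ H E1; rewrite size_compile in E2.
  have [m2 R2 H2] := IH2 w2 _ _ H1 E2.
  by exists m2 => //; rewrite addnA; apply: runs_cat R1 R2.
- move=> r c1 c2 s s' t r0 _ IH /and3P[wr w1 w2] k m H [E0 /code_at_cat[E1 /= [E2 _]]].
  rewrite size_compile in E2.
  have [m1 R1 H1] := IH w1 _ _ H E1; exists m1 => //.
  rewrite /obs /cur_instr /= E0; split=> //.
  have [_ _ E _ _] := H; rewrite E //; move/eqP/negbTE: r0 => ->.
  rewrite -cats1; apply: runs_cat R1 _.
  by rewrite /= /obs /cur_instr /= E2; split=> //; congr (_, _); lia.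
- move=> r c1 c2 s s' t r0 _ IH /and3P[wr w1 w2] k m H [E0 /code_at_cat[E1 /= [_ E2]]].
  rewrite size_compile in E2.
  have E3 : (k.+1 + clen c1).+1 = k + clen c1 + 2 by lia.
  rewrite E3 in E2.
  have [m1 R1 H1] := IH w2 _ _ H E2; exists m1 => //.
  rewrite /obs /cur_instr /= E0; split=> //.
  have [_ _ E _ _] := H; rewrite E // r0 /=.
  by have -> : k + (clen c1 + clen c2 + 2) = k + clen c1 + 2 + clen c2 by lia.
- move=> r c s r0 /andP[wr w] k m H [E0 _]; exists m => //.
  have [_ _ E _ _] := H.
  by rewrite /obs /cur_instr /= E0 E // r0 /=; split=> //; congr (_, _); lia.
- move=> r c s1 s2 s3 t1 t2 r0 _ IH1 _ IH2 /andP[wr w] k m H /[dup] E /= [E0 /code_at_cat[E1 /= [E2 _]]].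
  rewrite size_compile in E2.
  have [m1 R1 H1] := IH1 w _ _ H E1.
  have [|m2 R2 H2] := IH2 _ k _ H1 E; first by rewrite wr.
  exists m2 => //; rewrite /obs /cur_instr /= E0; split=> //.
  have [_ _ Er _ _] := H; rewrite Er //; move/eqP/negbTE: r0 => ->.
  apply: runs_cat R2; rewrite -cats1; apply: runs_cat R1 _.
  by rewrite /= /obs /cur_instr /= E2.
Qed.

End Execution.

(** * Frame conditions and code without output *)

Definition frame (rs js : seq nat) (s s' : state) : Prop :=
  (forall r, r \notin rs -> rg s' r = rg s r) /\
  (forall j, j \notin js -> ar s' j = ar s j).

Definition writes1 (rs js : seq nat) (o : op) : bool :=
  match o with
  | OConst r _ | OAdd r _ _ | OSub r _ _ | OLt r _ _ | OLoad r _ _ => r \in rs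
  | OStore j _ _ => j \in js
  | OOut _ _ => true
  end.

Fixpoint writes (rs js : seq nat) (c : cmd) : bool :=
  match c with
  | Blk l => all (writes1 rs js) l
  | Raw r _ => r \in rs
  | Seq c1 c2 | If _ c1 c2 => writes rs js c1 && writes rs js c2
  | While _ c => writes rs js c
  end.

Definition silent1 (o : op) : bool := if o is OOut _ _ then false else true.

Fixpoint silent (c : cmd) : bool :=
  match c with
  | Blk l => all silent1 l
  | Raw _ _ => true
  | Seq c1 c2 | If _ c1 c2 => silent c1 && silent c2
  | While _ c => silent c
  end.

Lemma frame_refl rs js s : frame rs js s s.
Proof. by []. Qed.

Lemma frame_trans rs js s1 s2 s3 :
  frame rs js s1 s2 -> frame rs js s2 s3 -> frame rs js s1 s3.
Proof. by move=> [a b] [c d]; split=> x hx; rewrite ?c ?d ?a ?b. Qed.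

Lemma upd_notin g a v (rs : seq nat) r : r \notin rs -> a \in rs -> upd g a v r = g r.
Proof. by rewrite /upd => h1 h2; rewrite ifN //; apply: contraNneq h1 => ->. Qed.

Lemma frame_blk rs js s l : all (writes1 rs js) l -> frame rs js s (sem s l).
Proof.
elim: l s => [|o l IH] s /=; first by move=> _; apply: frame_refl.
move=> /andP[w1 w2]; apply: frame_trans (IH _ w2).
case: s o w1 => g f [] //= *; split=> //= r hr.
all: try by apply: upd_notin hr _.
by rewrite /upda ifN //; apply: contraNneq hr => ->.
Qed.

Lemma writes_sub rs rs' js c : {subset rs <= rs'} -> writes rs js c -> writes rs' js c.
Proof.
move=> h; elim: c => //= [l|r v|c1 IH1 c2 IH2|r c1 IH1 c2 IH2].
- by apply: sub_all => o; case: o => //= r *; apply: h.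
- exact: h.
- by move=> /andP[/IH1 -> /IH2 ->].
- by move=> /andP[/IH1 -> /IH2 ->].
Qed.

Lemma tr_silent s l : all silent1 l -> tr s l = nseq (clen (Blk l)) None.
Proof.
elim: l s => //= o l IH s /andP[so sl]; rewrite IH // size_cat nseqD.
by case: o so.
Qed.

Lemma size_tr s l : size (tr s l) = clen (Blk l).
Proof.
elim: l s => //= o l IH s; rewrite !size_cat IH /=; congr addn.
by case: o => //= *; rewrite size_nseq.
Qed.

(** An address takes 18 instructions (a constant, sixteen additions, the base) and the access one
    more; 20 is a round bound. *)
Lemma clen_blk l : clen (Blk l) <= 20 * size l.
Proof.
elim: l => //= o l IH; rewrite size_cat.
suff : size (code1 o) <= 20 by move: IH => /=; lia.
have H j v : size (addr j v) = 18 by rewrite /addr unlock.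
by case: o => //= *; rewrite size_rcons H.
Qed.

(** * Total correctness with a bound on the number of steps *)

Section WeakestPreconditions.
Variables (inp : nat -> nat) (lim : nat).
Local Notation exec := (exec inp lim).

Lemma exec_frame rs js c s s' t : exec c s s' t -> writes rs js c -> frame rs js s s'.
Proof.
elim=> {c s s' t} /=.
- by move=> *; apply: frame_blk.
- by move=> r v s _ hr; split=> //= x hx; apply: upd_notin hx hr.
- move=> c1 c2 s1 s2 s3 t1 t2 _ IH1 _ IH2 /andP[w1 w2].
  exact: frame_trans (IH1 w1) (IH2 w2).
- by move=> r c1 c2 s s' t _ _ IH /andP[w1 w2]; apply: IH.
- by move=> r c1 c2 s s' t _ _ IH /andP[w1 w2]; apply: IH.
- by move=> *; apply: frame_refl.
- by move=> r c s1 s2 s3 t1 t2 _ _ IH1 _ IH2 w; apply: frame_trans (IH1 w) (IH2 w).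
Qed.

Lemma exec_silent c s s' t : exec c s s' t -> silent c -> t = nseq (size t) None.
Proof.
elim=> {c s s' t} //=.
- by move=> l s h; rewrite tr_silent // size_nseq.
- move=> c1 c2 s1 s2 s3 t1 t2 _ IH1 _ IH2 /andP[w1 w2].
  by rewrite size_cat nseqD -IH1 // -IH2.
- move=> r c1 c2 s s' t _ _ IH /andP[w1 w2].
  by rewrite size_rcons -addn1 nseqD -IH // cats1.
- by move=> r c1 c2 s s' t _ _ IH /andP[w1 w2]; rewrite -IH.
- move=> r c s1 s2 s3 t1 t2 _ _ IH1 _ IH2 w.
  by rewrite size_cat nseqD size_rcons -addn1 nseqD -IH1 // -IH2 // cats1.
Qed.

(** The trace is forgotten except for its length, which is enough for code without output. *)
Definition pwp (c : cmd) (k : nat) (Q : state -> Prop) (s : state) : Prop :=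
  exists s' t, [/\ exec c s s' t, size t <= k & Q s'].

Lemma pwp_blk l Q s : Q (sem s l) -> pwp (Blk l) (20 * size l) Q s.
Proof.
move=> q; exists (sem s l), (tr s l); split=> //; first exact: EBlk.
by rewrite size_tr clen_blk.
Qed.

Lemma pwp_seq c1 c2 k1 k2 Q s :
  pwp c1 k1 (pwp c2 k2 Q) s -> pwp (Seq c1 c2) (k1 + k2) Q s.
Proof.
move=> [s1 [t1 [e1 h1 [s2 [t2 [e2 h2 q]]]]]]; exists s2, (t1 ++ t2); split=> //.
- exact: ESeq e1 e2.
- by rewrite size_cat leq_add.
Qed.

Lemma pwp_if r c1 c2 k Q s :
  (rg s r <> 0 -> pwp c1 k Q s) -> (rg s r = 0 -> pwp c2 k Q s) ->
  pwp (If r c1 c2) (k + 2) Q s.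
Proof.
move=> h1 h2; have [e|/eqP e] := eqVneq (rg s r) 0.
- have [s1 [t1 [e1 h q]]] := h2 e; exists s1, (None :: t1); split=> //=; last lia.
  exact: EIf0.
- have [s1 [t1 [e1 h q]]] := h1 e; exists s1, (None :: rcons t1 None).
  split=> //; last by rewrite /= size_rcons; lia.
  exact: EIf1.
Qed.

Lemma pwp_mono c k k' (Q Q' : state -> Prop) s :
  pwp c k Q s -> k <= k' -> (forall s', Q s' -> Q' s') -> pwp c k' Q' s.
Proof.
move=> [s1 [t1 [e1 h q]]] hk hq; exists s1, t1; split=> //; last exact: hq.
exact: leq_trans hk.
Qed.

Lemma pwp_frame rs js c k Q s : writes rs js c -> pwp c k Q s ->
  pwp c k (fun s' => frame rs js s s' /\ Q s') s.
Proof.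
move=> w [s1 [t1 [e1 h q]]]; exists s1, t1; split=> //; split=> //.
exact: exec_frame e1 w.
Qed.

(** [I i] is the invariant after [i] iterations. Fixing the number [n] of iterations in advance
    yields the step count: 2 jumps per iteration and 1 failing test. *)
Lemma pwp_while rs js r c k (I : nat -> state -> Prop) n s0 :
  writes rs js c -> I 0 s0 ->
  (forall i s, i < n -> frame rs js s0 s -> I i s -> rg s r <> 0 /\ pwp c k (I i.+1) s) ->
  (forall s, I n s -> rg s r = 0) ->
  pwp (While r c) (n * (k + 2) + 1) (fun s => frame rs js s0 s /\ I n s) s0.
Proof.
move=> w I0 step stop.
suff H m i s : i + m = n -> frame rs js s0 s -> I i s ->
    pwp (While r c) (m * (k + 2) + 1) (fun s => frame rs js s0 s /\ I n s) s.
  by apply: (H n 0) => //; rewrite ?add0n.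
elim: m i s => [|m IH] i s /=.
  rewrite addn0 => -> f Is; exists s, [:: None]; split=> //.
  by apply: EWhile0; apply: stop.
move=> im f Is; have [|r0 [s1 [t1 [e1 h1 q1]]]] := step i s _ f Is; first lia.
have f1 := frame_trans f (exec_frame e1 w).
have [|s2 [t2 [e2 h2 q2]]] := IH i.+1 s1 _ f1 q1; first lia.
exists s2, (None :: rcons t1 None ++ t2); split=> //.
  exact: EWhile1 e1 e2.
by rewrite /= size_cat size_rcons; lia.
Qed.

End WeakestPreconditions.

(* [rV] is the loop pointer and [rC] the loop or branch condition; the tuple
   under the pointer is loaded into [rX], [rY]. [rRE], [rSE] are the end
   addresses of [R] and [S], [rN4] is 4 |D|, [rTH] the emission threshold
   4 |D|^2, [rYS] the chosen join value and [rBE] its number of pairs; [rP],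
   [rQ] locate the next pair to emit and [rREM] counts the remaining ones. *)
Notation rV := 4 (only parsing).
Notation rC := 5 (only parsing).
Notation rX := 6 (only parsing).
Notation rY := 7 (only parsing).
Notation rZ := 8 (only parsing).
Notation r1 := 9 (only parsing).
Notation r2 := 10 (only parsing).
Notation rRE := 11 (only parsing).
Notation rSE := 12 (only parsing).
Notation rW := 13 (only parsing).
Notation rJ := 14 (only parsing).
Notation rTH := 15 (only parsing).
Notation rBE := 16 (only parsing).
Notation rYS := 17 (only parsing).
Notation rD := 18 (only parsing).
Notation rF := 19 (only parsing).
Notation rNA := 20 (only parsing).
Notation rNB := 21 (only parsing).
Notation rACC := 22 (only parsing).
Notation rREM := 23 (only parsing).
Notation rP := 24 (only parsing).
Notation rQ := 25 (only parsing).
Notation rPT := 26 (only parsing).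
Notation rCU := 27 (only parsing).
Notation rN4 := 28 (only parsing).

(** * Scans of a relation *)

Definition loads := [:: OLoad rX 0 rV; OAdd rD rV r1; OLoad rY 0 rD].
Definition incr e := [:: OAdd rV rV r2; OLt rC rV e].

Definition scan e c :=
  Seq (Blk [:: OLt rC rV e])
    (While rC (Seq (Blk loads) (Seq c (Blk (incr e))))).

(* Tuple number [i] of the input occupies the cells [2 + 2 * i] and [3 + 2 * i]. *)
Definition stored (f : nat -> nat) (k : nat) (L : relation) : Prop :=
  forall i, i < size L ->
    f (2 + 2 * (k + i)) = (nth (0, 0) L i).1 /\ f (3 + 2 * (k + i)) = (nth (0, 0) L i).2.

Lemma upd_eq g a v : upd g a v a = v.
Proof. by rewrite /upd eqxx. Qed.

Section Scan.
Variables (inp : nat -> nat) (lim : nat).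
Local Notation pwp := (pwp inp lim).

(** [I] speaks of the state at the loop test, hence the [incr e] in the obligation on the body. Each
    tuple costs 60 steps for [loads], 40 for [incr] and 2 jumps besides [c]. *)
Lemma pwp_scan rs js e c kc (L : relation) k (I : nat -> state -> Prop) s0 :
  writes rs js c -> e \notin rV :: rC :: rX :: rY :: rD :: rs ->
  [&& rV \notin rs, r1 \notin rs, r2 \notin rs & 0 \notin js] ->
  stored (ar s0 0) k L -> rg s0 rV = 2 + 2 * k -> rg s0 e = 2 + 2 * (k + size L) ->
  rg s0 r1 = 1 -> rg s0 r2 = 2 ->
  I 0 (sem s0 [:: OLt rC rV e]) ->
  (forall i s, i < size L -> frame (rV :: rC :: rX :: rY :: rD :: rs) js s0 s -> I i s ->
     rg s rV = 2 + 2 * (k + i) ->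
     pwp c kc (fun s' => I i.+1 (sem s' (incr e)))
       (State (upd (upd (upd (rg s) rX (nth (0, 0) L i).1) rD (3 + 2 * (k + i))) rY (nth (0, 0) L i).2) (ar s))) ->
  pwp (scan e c) (size L * (kc + 102) + 21)
    (fun s => frame (rV :: rC :: rX :: rY :: rD :: rs) js s0 s /\ I (size L) s) s0.
Proof.
move=> w he /and4P[h1 h2 h3 h4] st v0 e0 o0 t0 I0 step.
set rs' := rV :: rC :: rX :: rY :: rD :: rs.
have w' : writes rs' js c by apply: writes_sub w => x; rewrite !inE => ->; rewrite !orbT.
rewrite /scan; apply: (pwp_mono (k := 20 * 1 + (size L * (60 + (kc + 40) + 2) + 1))); last by move=> s; apply.
  apply: pwp_seq; apply: pwp_blk.
  set s1 := sem _ _.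
  pose J i s := [/\ I i s, rg s rV = 2 + 2 * (k + i) & rg s rC = (i < size L)].
  have fr1 : frame rs' js s0 s1.
    exact: frame_blk.
  have wh : writes rs' js (Seq (Blk loads) (Seq c (Blk (incr e)))).
    by rewrite /= w'.
  have Es1 : ar s1 = ar s0 /\ rg s1 = upd (rg s0) rC (rg s0 rV < rg s0 e) by rewrite /s1; case: (s0).
  have [E1 E2] := Es1.
  apply: (pwp_mono (@pwp_while inp lim rs' js rC _ (60 + (kc + 40)) J (size L) s1 wh _ _ _)) => //.
  - split=> //; first by rewrite E2 /upd /= v0 addn0.
    rewrite E2 /upd /= v0 e0; congr nat_of_bool; lia.
  - move=> i s il fr [Is v c0]; rewrite c0 il; split=> //.
    have fr0 := frame_trans fr1 fr; have [fa fb] := fr0.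
    apply: pwp_seq; apply: (@pwp_blk inp lim loads).
    have [z0 z1] := st i il.
    have -> : sem s loads = State (upd (upd (upd (rg s) rX (nth (0, 0) L i).1) rD (3 + 2 * (k + i))) rY (nth (0, 0) L i).2) (ar s).
      have E3 : 3 + 2 * (k + i) = rg s rV + rg s r1 by rewrite v (fa r1) ?o0 //; lia.
      by rewrite -z0 -z1 -(fb 0) // -v E3; case: (s).
    apply: pwp_seq; have := step i s il fr0 Is v.
    move=> /(pwp_frame w) H; apply: pwp_mono H _ _ => // s' [[f1 f2] Q].
    apply: (@pwp_blk inp lim (incr e)); split=> //.
    + have := f1 rV h1; have := f1 r2 h3; rewrite /upd /=.
      case: (s') => g f /= -> ->; rewrite /upd /= v fa ?t0; first lia.
      by rewrite !inE.
    + have := f1 rV h1; have := f1 r2 h3; have he' : e \notin rs by move: he; rewrite !inE !negb_or => /and5P[_ _ _ _ /andP[]].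
      have := f1 e he'; rewrite /upd /=.
      have [e1 [e2 [e3 e4]]] : e != rV /\ e != rX /\ e != rY /\ e != rD.
        by move: he; rewrite !inE !negb_or => /and5P[? ? ? ? /andP[]].
      rewrite (negbTE e2) (negbTE e3) (negbTE e4) fa // e0 (fa r2) ?inE // t0.
      case: (s') => g f /= E -> ->; rewrite /upd /= (negbTE e1) E v.
      congr nat_of_bool; lia.
  - by move=> s [_ _ ->]; rewrite ltnn.
  - by move=> s [fr [Is _ _]]; split=> //; apply: frame_trans fr.
lia.
Qed.
End Scan.

Arguments upd _ _ _ _ /.
Arguments upda _ _ _ _ _ /.

(** * Loops of the preprocessing *)

Notation r0 := 3 (only parsing).

(* The linked list starting at [h], with links [nx], carries the values [l];
   address 0 is the end of the list, and all its nodes are below [b]. *)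
Fixpoint chain (nx z : nat -> nat) (b h : nat) (l : seq nat) : Prop :=
  if l is x :: l' then [/\ 0 < h < b, z h.+1 = x & chain nx z b (nx h) l'] else h = 0.

(** Nodes are the addresses of the scanned tuples, which increase; writing the link of the next node
    therefore leaves the existing lists intact. *)
Lemma chain_upd nx z b b' h l v : b <= b' ->
  chain nx z b h l -> chain (upd nx b v) z b' h l.
Proof.
move=> bb; elim: l h => //= x l IH h [h1 h2 h3]; split=> //; first lia.
by rewrite /upd ifN; [apply: IH | apply/eqP; lia].
Qed.

(** Reversed, because the scan pushes each tuple at the head of its list. *)
Definition slist (y : nat) (L : relation) : seq nat :=
  [seq t.2 | t <- rev L & t.1 == y].

Lemma slist_rcons y L t :
  slist y (rcons L t) = if t.1 == y then t.2 :: slist y L else slist y L.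
Proof. by rewrite /slist rev_rcons /=; case: eqP. Qed.

(* Arrays: 0 input; 1 links and 2 heads of the lists of S-tuples sharing a join
   value; 3 degrees in S; 4 pairs per join value; 5 row offset of each x in the
   table 6 of written pairs; 7 and 8 the x's and z's of the chosen join value,
   9 and 10 their membership tests; 11 the test for the chosen join value. *)
Definition index_S : cmd := scan rSE (Blk
  [:: OLoad rD 2 rX; OStore 1 rV rD; OStore 2 rX rV;
      OLoad rD 3 rX; OAdd rD rD r1; OStore 3 rX rD;
      OAdd rW rW rY; OAdd rW rW r1; OAdd rTH rTH rN4]).

Definition weigh_R : cmd := scan rRE (Seq (Blk
  [:: OLoad rD 3 rY; OAdd rJ rJ rD; OLoad rF 4 rY; OAdd rF rF rD;
      OStore 4 rY rF; OLt rC rBE rF])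
  (Seq (If rC (Blk [:: OAdd rBE rF r0; OAdd rYS rY r0]) (Blk [::]))
  (Blk [:: OStore 5 rX rCU; OAdd rCU rCU rW; OAdd rTH rTH rN4]))).

(** Branch-free: each value is written at the current end of [arr], and the end advances by the test
    bit, so an unwanted value is overwritten by the next one or left beyond the end. *)
Definition collect (b : bool) (e cnt arr mark : nat) : cmd :=
  let: (key, val) := if b then (rX, rY) else (rY, rX) in
  scan e (Blk [:: OLoad rF 11 key; OStore arr cnt val; OAdd cnt cnt rF;
     OLoad rD mark val; OAdd rD rD rF; OStore mark val rD]).

Section Loops.
Variables (inp : nat -> nat) (lim : nat).
Local Notation pwp := (pwp inp lim).

(** Adding z + 1 for every tuple makes [rW] exceed each z without computing a maximum. [rTH] gains 4
    |D| per tuple here and in [weigh_R], which builds 4 |D|^2 by additions. *)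
Lemma index_SP (S : relation) k s0 :
  stored (ar s0 0) k S -> rg s0 rV = 2 + 2 * k -> rg s0 rSE = 2 + 2 * (k + size S) ->
  rg s0 r1 = 1 -> rg s0 r2 = 2 -> rg s0 rW = 0 -> rg s0 rTH = 0 ->
  (forall y, ar s0 2 y = 0) -> (forall y, ar s0 3 y = 0) ->
  pwp index_S (size S * 282 + 21) (fun s =>
    frame [:: rV; rC; rX; rY; rD; rD; rW; rTH] [:: 1; 2; 3] s0 s /\
    [/\ forall y, chain (ar s 1) (ar s 0) (2 + 2 * (k + size S)) (ar s 2 y) (slist y S),
        forall y, ar s 3 y = count (fun t => t.1 == y) S,
        forall t, t \in S -> t.2 < rg s rW
      & rg s rTH = size S * rg s0 rN4]) s0.
Proof.
move=> st v0 e0 o0 t0 w0 th0 a2 a3.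
pose I i s := [/\ forall y, chain (ar s 1) (ar s 0) (2 + 2 * (k + i)) (ar s 2 y) (slist y (take i S)),
        forall y, ar s 3 y = count (fun t => t.1 == y) (take i S),
        forall t, t \in take i S -> t.2 < rg s rW
      & rg s rTH = i * rg s0 rN4].
have := @pwp_scan inp lim [:: rD; rW; rTH] [:: 1; 2; 3] rSE (Blk
  [:: OLoad rD 2 rX; OStore 1 rV rD; OStore 2 rX rV;
      OLoad rD 3 rX; OAdd rD rD r1; OStore 3 rX rD;
      OAdd rW rW rY; OAdd rW rW r1; OAdd rTH rTH rN4]) 180 S k I s0 erefl erefl erefl st v0 e0 o0 t0.
move=> H; apply: pwp_mono (H _ _) _ _ => {H} //; last 1 first.
- by move=> s [fr Is]; split=> //; move: Is; rewrite /I take_size.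
- rewrite /I; case: s0 a2 a3 w0 th0 {st v0 e0 o0 t0 I} => g f /= a2 a3 w0 th0.
  by split=> [y|y|t|]; rewrite ?take0 ?a2 ?a3.
move=> i s il [fa fb] [h1 h2 h3 h4] V; apply: (@pwp_blk inp lim).
move: (fa r1 isT) (fa rN4 isT) (fb 0 isT); rewrite o0.
rewrite /I; case: s V h1 h2 h3 h4 {fa fb} => g f /= V h1 h2 h3 h4 E1 E2 E3.
have [_ z1] := st i il.
rewrite (take_nth (0, 0) il) E1 E2 h4; move: (nth _ S i) z1 => t z1; split=> [y|y|t'|].
- rewrite slist_rcons (eq_sym t.1) V; case: eqP => [->|_]; last by apply: chain_upd (h1 y); lia.
  rewrite /= eqxx; split=> //; first lia.
  + by rewrite E3 -addSn z1.
  + by apply: chain_upd (h1 _); lia.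
- rewrite -cats1 count_cat /= !h2 addn0 (eq_sym t.1); case: eqP => [->|_] /=; lia.
- rewrite mem_rcons inE => /predU1P[->|/h3]; lia.
- lia.
Qed.

(** Every tuple of join value y adds b_y to entry y of array 4, which thus reaches a_y b_y, and the
    maximum is updated on the fly. The offset of x is rewritten at each tuple containing x; the last
    index [j] is kept, and it determines x, so different x get different rows. *)
Lemma weigh_RP (R : relation) k (b : nat -> nat) s0 :
  stored (ar s0 0) k R -> rg s0 rV = 2 + 2 * k -> rg s0 rRE = 2 + 2 * (k + size R) ->
  rg s0 r0 = 0 -> rg s0 r1 = 1 -> rg s0 r2 = 2 ->
  rg s0 rJ = 1 -> rg s0 rBE = 0 -> rg s0 rCU = 0 ->
  (forall y, ar s0 3 y = b y) -> (forall y, ar s0 4 y = 0) ->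
  pwp weigh_R (size R * 324 + 21) (fun s =>
    frame [:: rV; rC; rX; rY; rD; rD; rF; rJ; rC; rBE; rYS; rCU; rTH] [:: 4; 5] s0 s /\ [/\ rg s rJ = (\sum_(t <- R) b t.2).+1,
        forall y, ar s 4 y = count (fun t => t.2 == y) R * b y,
        (rg s rBE = ar s 4 (rg s rYS) /\ forall y, ar s 4 y <= rg s rBE),
        (forall x, x \in map fst R -> exists2 j, j < size R &
           (nth (0, 0) R j).1 = x /\ ar s 5 x = j * rg s0 rW)
      & rg s rTH = rg s0 rTH + size R * rg s0 rN4]) s0.
Proof.
move=> st v0 e0 z0 o0 t0 j0 be0 cu0 a3 a4.
pose I i s := [/\ rg s rJ = (\sum_(t <- take i R) b t.2).+1,
        forall y, ar s 4 y = count (fun t => t.2 == y) (take i R) * b y,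
        (rg s rBE = ar s 4 (rg s rYS) /\ forall y, ar s 4 y <= rg s rBE),
        (rg s rCU = i * rg s0 rW /\ forall x, x \in map fst (take i R) -> exists2 j, j < i &
           (nth (0, 0) R j).1 = x /\ ar s 5 x = j * rg s0 rW)
      & rg s rTH = rg s0 rTH + i * rg s0 rN4].
have := @pwp_scan inp lim [:: rD; rF; rJ; rC; rBE; rYS; rCU; rTH] [:: 4; 5] rRE (Seq (Blk
  [:: OLoad rD 3 rY; OAdd rJ rJ rD; OLoad rF 4 rY; OAdd rF rF rD;
      OStore 4 rY rF; OLt rC rBE rF])
  (Seq (If rC (Blk [:: OAdd rBE rF r0; OAdd rYS rY r0]) (Blk [::]))
  (Blk [:: OStore 5 rX rCU; OAdd rCU rCU rW; OAdd rTH rTH rN4]))) 222 R k I s0 erefl erefl erefl st v0 e0 o0 t0.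
move=> H; apply: pwp_mono (H _ _) _ _ => {H} //; last 1 first.
- move=> s [fr Is]; split=> //; move: Is; rewrite /I take_size => -[? ? ? [? ?] ?]; split=> //.
- rewrite /I; case: s0 a3 a4 j0 be0 cu0 {st v0 e0 z0 o0 t0 I} => g f /= a3 a4 j0 be0 cu0.
  rewrite take0 big_nil; split=> //; last by rewrite addn0.
  by rewrite be0; split=> [|y]; rewrite a4.
move=> i s il [fa fb] [h1 h2 [h3 h4] [h5 h6] h7] V.
rewrite -[222]/(20 * 6 + (20 * 2 + 2 + 20 * 3)).
apply: pwp_seq; apply: (@pwp_blk inp lim).
move: (fa r0 isT) (fa r1 isT) (fa rN4 isT) (fa rW isT) (fb 3 isT); rewrite o0 z0.
rewrite /I; case: s V h1 h2 h3 h4 h5 h6 h7 {fa fb} => g f /= V h1 h2 h3 h4 h5 h6 h7 E0 E1 E2 E3 E4.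
rewrite (take_nth (0, 0) il); set t := nth _ R i.
have C y : count (fun t => t.2 == y) (rcons (take i R) t) = count (fun t => t.2 == y) (take i R) + (t.2 == y).
  by rewrite -cats1 count_cat /= addn0.
have F1 : g 14 + f 3 t.2 = (\sum_(t1 <- rcons (take i R) t) b t1.2).+1.
  by rewrite -cats1 big_cat big_seq1 /= h1 E4 a3 addSn.
have F2 y : (if y == t.2 then f 4 t.2 + f 3 t.2 else f 4 y) =
    count (fun t1 : nat * nat => t1.2 == y) (rcons (take i R) t) * b y.
  rewrite C (eq_sym t.2); case: eqP => [->|_]; rewrite h2 ?E4 ?a3 ?addn0 //.
  by rewrite addn1 mulSn addnC.
have F4 : g 27 + g 13 = i.+1 * rg s0 13 /\
    (forall x, x \in [seq t.1 | t <- rcons (take i R) t] -> exists2 j, j < i.+1 &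
       (nth (0, 0) R j).1 = x /\ (if x == t.1 then g 27 else f 5 x) = j * rg s0 13).
  split; first by rewrite h5 E3 mulSn addnC.
  move=> x; rewrite map_rcons mem_rcons inE; have [->|_ /= /h6[j ji H]] := eqVneq.
    by exists i.
  by exists j; first exact: leqW.
have F5 : g 15 + g 28 = rg s0 15 + i.+1 * rg s0 28 by rewrite h7 E2; lia.
apply: pwp_seq; apply: pwp_if => /= ble; [|apply: (pwp_mono (@pwp_blk inp lim [::] _ _ _)) => //; last by move=> s; apply].
- apply: (@pwp_blk inp lim [:: _; _]); apply: (@pwp_blk inp lim [:: _; _; _]) => /=.
  split=> //; rewrite E0 !addn0 eqxx; split=> // y; case: eqP => // _.
  by apply: leq_trans (h4 y) _; lia.
- apply: (@pwp_blk inp lim [:: _; _; _]) => /=.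
  (* If [t.2] is the value already chosen, the failed test forces its degree in [S] to be 0, so the
     recorded maximum is still exact. *)
  split=> //; split=> [|y]; case: eqP => // E; first by move: ble (h3); rewrite E; lia.
  by lia.
Qed.

Lemma collectP d (L : relation) k e cnt arr mark s0 :
  (d, e, cnt, arr, mark) \in [:: (true, rSE, rNB, 8, 10); (false, rRE, rNA, 7, 9)] ->
  stored (ar s0 0) k L -> rg s0 rV = 2 + 2 * k -> rg s0 e = 2 + 2 * (k + size L) ->
  rg s0 r1 = 1 -> rg s0 r2 = 2 -> rg s0 cnt = 0 -> (forall y, ar s0 mark y = 0) ->
  forall y0, (forall y, ar s0 11 y = (y == y0)) ->
  let p t := (if d then t.1 else t.2) == y0 in
  let v (t : nat * nat) := if d then t.2 else t.1 in
  pwp (collect d e cnt arr mark) (size L * 222 + 21) (fun s =>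
    frame [:: rV; rC; rX; rY; rD; rD; rF; cnt] [:: arr; mark] s0 s /\
    [/\ rg s cnt = count p L,
        forall i, i < count p L -> ar s arr i = nth 0 [seq v t | t <- L & p t] i
      & forall x, ar s mark x = count (fun t => p t && (v t == x)) L]) s0.
Proof.
move=> hd st v0 e0 o0 t0 c0 m0 y0 h11 p v.
pose I i s := [/\ rg s cnt = count p (take i L),
        forall j, j < count p (take i L) -> ar s arr j = nth 0 [seq v t | t <- take i L & p t] j
      & forall x, ar s mark x = count (fun t => p t && (v t == x)) (take i L)].
have := @pwp_scan inp lim [:: rD; rF; cnt] [:: arr; mark] e (let: (key, val) := if d then (rX, rY) else (rY, rX) in Blk [:: OLoad rF 11 key; OStore arr cnt val; OAdd cnt cnt rF;
     OLoad rD mark val; OAdd rD rD rF; OStore mark val rD]) 120 L k I s0.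
have -> : scan e (let: (key, val) := if d then (rX, rY) else (rY, rX) in Blk [:: OLoad rF 11 key; OStore arr cnt val; OAdd cnt cnt rF;
     OLoad rD mark val; OAdd rD rD rF; OStore mark val rD]) = collect d e cnt arr mark by case: (d).
move: hd; rewrite /I /v /p !inE => /orP[] /eqP[? ? ? ? ?]; subst => {I v p}.
all: move=> /(_ erefl erefl erefl st v0 e0 o0 t0) H; apply: pwp_mono (H _ _) _ _ => {H} //.
all: try by [move=> s [fr Is]; split=> //; move: Is; rewrite take_size].
all: try by [case: s0 c0 m0 {st v0 e0 o0 t0 h11} => g f /= c0 m0; rewrite take0].
all: move=> i s il [fa fb] [h1 h2 h3] V; apply: (@pwp_blk inp lim [:: _; _; _; _; _; _]).
all: move: (fb 11 isT); case: s h1 h2 h3 {fa fb V} => g f /= h1 h2 h3 E1.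
all: rewrite (take_nth (0, 0) il); move: (nth _ L i) => t.
all: rewrite !E1 !h11 -!cats1 !count_cat /= !addn0 !filter_cat !map_cat h1; split=> // [j|x].
1,3: move=> jl; rewrite nth_cat size_map size_filter; case: eqP => [E|ne].
1,3: by rewrite E ltnn subnn /=; move: jl; rewrite E; case: eqP => //=; rewrite addn0 ltnn.
1,2: by rewrite ifT ?h2 //; move: jl ne; set c := count _ _; case: eqP => _ /=; lia.
- by rewrite count_cat /= addn0 !h3 (eq_sym t.2); case: eqP => [->|_]; rewrite ?andbT ?andbF ?addn0.
- by rewrite count_cat /= addn0 !h3 (eq_sym t.1); case: eqP => [->|_]; rewrite ?andbT ?andbF ?addn0.
Qed.

(** The cells below 32 are moved beforehand, because registers live there; the loop moves the rest.
    Its writes land at [B] or above, past the input. *)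
Lemma copyP s0 :
  rg s0 r1 = 1 -> rg s0 rV = 32 -> rg s0 rSE = lim ->
  pwp (Seq (Blk [:: OLt rC rV rSE]) (While rC (Seq (Raw rD rV)
        (Blk [:: OStore 0 rV rD; OAdd rV rV r1; OLt rC rV rSE])))) ((lim - 32) * 63 + 21) (fun s =>
    frame [:: rC; rD; rV] [:: 0] s0 s /\
    forall v, v < lim -> ar s 0 v = if v < 32 then ar s0 0 v else inp v) s0.
Proof.
move=> o0 v0 e0.
pose I i s := [/\ rg s rV = 32 + i, rg s rC = (32 + i < lim)
  & forall v, v < 32 + i -> ar s 0 v = if v < 32 then ar s0 0 v else inp v].
apply: (@pwp_mono _ _ _ (20 * 1 + ((lim - 32) * (61 + 2) + 1))); last by move=> s; apply.
  apply: pwp_seq; apply: (@pwp_blk inp lim [:: _]).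
  set s1 := sem _ _.
  have fr1 : frame [:: rC; rD; rV] [:: 0] s0 s1 by apply: frame_blk.
  apply: (pwp_mono (@pwp_while inp lim [:: rC; rD; rV] [:: 0] rC _ 61 I (lim - 32) s1 _ _ _ _)) => //.
  - rewrite /I /s1; case: (s0) v0 e0 => g f /= -> ->; rewrite addn0.
    by split=> // v ->.
  - move=> i s il fr [h1 h2 h3]; split; first by rewrite h2; lia.
    have [fa _] := frame_trans fr1 fr.
    rewrite -[61]/(1 + 20 * 3); apply: pwp_seq.
    exists (State (upd (rg s) rD (inp (rg s rV))) (ar s)), [:: None]; split=> //.
      by apply: ERaw; rewrite h1; lia.
    apply: (@pwp_blk inp lim [:: _; _; _]); move: (fa r1 isT) (fa rSE isT).
    rewrite /I; case: s h1 h2 h3 {fr fa} => g f /= -> _ h3 -> ->; rewrite o0 e0.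
    split; rewrite ?addnS ?addn0 // => v; rewrite ltnS leq_eqVlt.
    by case: eqP => [-> _|_ /=]; [rewrite ltnNge leq_addr | apply: h3].
  - by move=> s [_ -> _]; case: ltnP => //; lia.
  - move=> s [fr [_ _ h3]]; split; first exact: frame_trans fr.
    by move=> v hv; apply: h3; lia.
lia.
Qed.
End Loops.

(** * The whole preprocessing *)

Definition init : seq op :=
  [:: OConst r0 0; OConst r1 1; OConst r2 2;
      OAdd rN4 0 0; OAdd rSE rN4 r2; OAdd rN4 rN4 rN4;
      OAdd rD rN4 rN4; OAdd rD rD rD; OAdd rD rD rD; OSub rD 1 rD;
      OSub rRE 0 rD; OAdd rRE rRE rRE; OAdd rRE rRE r2;
      OConst rW 0; OConst rJ 1; OConst rTH 0; OConst rBE 0; OConst rYS 0;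
      OConst rNA 0; OConst rNB 0; OConst rACC 0; OConst rP 0; OConst rQ 0;
      OConst rCU 0; OConst rV 32].

Definition copy : cmd :=
  Seq (Blk [:: OLt rC rV rSE]) (While rC (Seq (Raw rD rV)
    (Blk [:: OStore 0 rV rD; OAdd rV rV r1; OLt rC rV rSE]))).

Definition digest : cmd :=
  Seq (Blk [:: OAdd rV rRE r0]) (Seq index_S
  (Seq (Blk [:: OConst rV 2]) (Seq weigh_R
  (Seq (Blk [:: OStore 11 rYS r1; OAdd rV rRE r0]) (Seq (collect true rSE rNB 8 10)
  (Seq (Blk [:: OConst rV 2]) (Seq (collect false rRE rNA 7 9)
  (Blk [:: OAdd rREM rBE r0; OConst rV 2; OLt rC rV rRE])))))))).

Definition prep : cmd := Seq (Blk init) (Seq copy digest).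

Definition deg1 y (L : relation) := count (fun t => t.1 == y) L.
Definition deg2 y (L : relation) := count (fun t => t.2 == y) L.
Definition joinsize (R S : relation) := \sum_(t <- R) deg1 t.2 S.

(** The facts that survive the whole enumeration: they involve only registers outside [dyn_rs] and
    arrays other than 6. The initial values of what does change are in [fresh]. *)
Record ready (R S : relation) (s : state) : Prop := Ready {
  ready_r0 : rg s r0 = 0;
  ready_r1 : rg s r1 = 1;
  ready_r2 : rg s r2 = 2;
  ready_RE : rg s rRE = 2 + 2 * size R;
  ready_R : stored (ar s 0) 0 R;
  ready_chain y : chain (ar s 1) (ar s 0) (2 + 2 * (size R + size S)) (ar s 2 y) (slist y S);
  ready_J : rg s rJ = (joinsize R S).+1;
  ready_TH : rg s rTH = 4 * (size R + size S) ^ 2;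
  ready_best : rg s rBE = deg2 (rg s rYS) R * deg1 (rg s rYS) S;
  ready_max y : deg2 y R * deg1 y S <= rg s rBE;
  ready_NB : rg s rNB = deg1 (rg s rYS) S;
  ready_xs i : i < deg2 (rg s rYS) R ->
    ar s 7 i = nth 0 [seq t.1 | t <- R & t.2 == rg s rYS] i;
  ready_zs i : i < deg1 (rg s rYS) S ->
    ar s 8 i = nth 0 [seq t.2 | t <- S & t.1 == rg s rYS] i;
  ready_mx x : ar s 9 x = ((x, rg s rYS) \in R);
  ready_mz z : ar s 10 z = ((rg s rYS, z) \in S);
  ready_key x z x' z' : x \in map fst R -> x' \in map fst R ->
    z \in map snd S -> z' \in map snd S ->
    ar s 5 x + z = ar s 5 x' + z' -> x = x' /\ z = z'
}.

Definition fresh (s : state) : Prop :=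
  [/\ forall i, ar s 6 i = 0, rg s rACC = 0, rg s rREM = rg s rBE,
      rg s rP = 0 /\ rg s rQ = 0 & rg s rV = 2 /\ rg s rC = (2 < rg s rRE)].

Definition loaded (inp : nat -> nat) (R S : relation) (s : state) : Prop :=
  [/\ rg s 0 = size R + size S, rg s 1 = size S + 32 * (size R + size S),
      forall v, 1 < v < 32 -> ar s 0 v = inp v
    & forall j v, 0 < j < 16 -> ar s j v = 0].

(** Transports each hypothesis on the old state to the new one where the frame permits it, and
    discards the others. *)
Ltac carry fr :=
  repeat match type of fr with frame _ _ ?s ?s' =>
    match goal with
    | H : rg s ?r = _ |- _ => first [rewrite -(proj1 fr r isT) in H | clear H]
    | H : context [ar s ?j] |- _ => first [rewrite -(proj2 fr j isT) in H | clear H]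
    end end.

Lemma nth_flat (L : relation) i : i < size L ->
  nth 0 (flatten [seq [:: t.1; t.2] | t <- L]) (2 * i) = (nth (0, 0) L i).1 /\
  nth 0 (flatten [seq [:: t.1; t.2] | t <- L]) (2 * i).+1 = (nth (0, 0) L i).2.
Proof.
elim: L i => // t L IH [//|i] hi; have := IH i hi.
by have -> : 2 * i.+1 = (2 * i).+2 by lia; move: (2 * i) => j [] /= -> ->.
Qed.

Lemma stored_enc (R S : relation) f :
  (forall v, 1 < v < 2 * (size R + size S) + 2 -> f v = nth 0 (enc_flat R S) v) ->
  stored f 0 R /\ stored f (size R) S.
Proof.
move=> h; split=> i hi; rewrite !h; try lia.
- by have := @nth_flat (R ++ S) i; rewrite size_cat nth_cat hi => -[|<- <-]; [lia | rewrite add0n].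
- have := @nth_flat (R ++ S) (size R + i).
  have E : (size R + i < size R) = false by lia.
  by rewrite size_cat nth_cat E addKn => -[|<- <-] //; lia.
Qed.

Lemma count_fst (L : relation) y x : uniq L ->
  count (fun t => (t.1 == y) && (t.2 == x)) L = ((y, x) \in L).
Proof.
by move=> /count_uniq_mem <-; apply: eq_count => -[a b] /=; rewrite xpair_eqE.
Qed.

Lemma count_snd (L : relation) y x : uniq L ->
  count (fun t => (t.2 == y) && (t.1 == x)) L = ((x, y) \in L).
Proof.
by move=> /count_uniq_mem <-; apply: eq_count => -[a b] /=; rewrite xpair_eqE andbC.
Qed.

Lemma key_inj W j z j' z' : z < W -> z' < W -> j * W + z = j' * W + z' -> j = j' /\ z = z'.
Proof.
move=> zW zW' E; have W0 : 0 < W by apply: leq_trans zW.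
have := congr1 (fun n => n %/ W) E; rewrite !divnMDl // !divn_small // !addn0 => jj.
by split=> //; move: E; rewrite jj => /addnI.
Qed.

Lemma pwp_step inp lim rs js l c k Q s : all (writes1 rs js) l ->
  (forall s', frame rs js s s' -> s' = sem s l -> pwp inp lim c k Q s') ->
  pwp inp lim (Seq (Blk l) c) (20 * size l + k) Q s.
Proof.
by move=> w H; apply: pwp_seq; apply: pwp_blk; apply: H => //; apply: frame_blk.
Qed.

Lemma pwp_last inp lim rs js l Q s : all (writes1 rs js) l ->
  (forall s', frame rs js s s' -> s' = sem s l -> Q s') ->
  pwp inp lim (Blk l) (20 * size l) Q s.
Proof. by move=> w H; apply: pwp_blk; apply: H => //; apply: frame_blk. Qed.

(** A tuple of [S] costs 282 + 222 steps and a tuple of [R] costs 324 + 222, in two scans each; 900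
    also covers the constant terms. *)
Lemma digestP inp lim (R S : relation) s1 :
  let N := size R + size S in
  uniq R -> uniq S -> stored (ar s1 0) 0 R -> stored (ar s1 0) (size R) S ->
  [/\ rg s1 r0 = 0, rg s1 r1 = 1 & rg s1 r2 = 2] ->
  [/\ rg s1 rSE = 2 + 2 * N, rg s1 rN4 = 4 * N, rg s1 rRE = 2 + 2 * size R & rg s1 rW = 0] ->
  [/\ rg s1 rJ = 1, rg s1 rTH = 0, rg s1 rBE = 0 & rg s1 rNA = 0] ->
  [/\ rg s1 rNB = 0, rg s1 rACC = 0, rg s1 rP = 0, rg s1 rQ = 0 & rg s1 rCU = 0] ->
  (forall j, j \in [:: 2; 3; 4; 6; 9; 10; 11] -> forall v, ar s1 j v = 0) ->
  pwp inp lim digest (900 * N.+1) (fun s => ready R S s /\ fresh s) s1.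
Proof.
move=> N uR uS sR sS [z0 o0 t0] [SE N4 RE W0] [J0 TH0 BE0 NA0] [NB0 ACC0 P0 Q0 CU0] aj.
have A2 := aj 2 isT; have A3 := aj 3 isT; have A4 := aj 4 isT; have A6 := aj 6 isT.
have A9 := aj 9 isT; have A10 := aj 10 isT; have A11 := aj 11 isT; clear aj.
apply: (pwp_mono (Q := fun s => ready R S s /\ fresh s)); last by move=> s; apply.
apply: (pwp_step (rs := [:: rV]) (js := [::])) => // s2 fr E2.
have {E2} V : rg s2 rV = 2 + 2 * size R.
  by rewrite E2; move: RE z0; case: (s1) => g f /= -> ->; rewrite addn0.
carry fr; clear fr.
apply: pwp_seq; apply: (pwp_mono (index_SP inp lim sS V SE o0 t0 W0 TH0 A2 A3)) => // s3 [fr [Ch B W TH]].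
have [w Ew {}W] : exists2 w, rg s3 rW = w & forall t, t \in S -> t.2 < w by exists (rg s3 rW).
rewrite N4 in TH; carry fr; clear fr.
apply: (pwp_step (rs := [:: rV]) (js := [::])) => // s4 fr E2.
have {E2} V2 : rg s4 rV = 2 + 2 * 0.
  by rewrite E2; case: (s3).
carry fr; clear fr.
apply: pwp_seq; apply: (pwp_mono (weigh_RP inp lim sR V2 RE z0 o0 t0 J0 BE0 CU0 B A4)) => // s5 [fr [J M [BE BM] K TH']].
rewrite Ew in K; rewrite TH N4 in TH'; carry fr; clear fr.
pose ys := rg s5 rYS.
apply: (pwp_step (rs := [:: rV]) (js := [:: 11])) => // s6 fr E2.
have {E2} [V3 A] : rg s6 rV = 2 + 2 * size R /\ forall y, ar s6 11 y = (y == ys).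
  rewrite E2 /ys; case: (s5) RE z0 o0 A11 => g f /= -> -> -> h.
  by split=> [|y]; rewrite ?addn0 ?h //; case: eqP.
have Eys : rg s5 rYS = ys by [].
rewrite Eys in BE; rewrite BE in BM; clear A11; carry fr; clear fr; clearbody ys.
have inT : (true, 12, 21, 8, 10) \in [:: (true, rSE, rNB, 8, 10); (false, rRE, rNA, 7, 9)] by [].
apply: pwp_seq; apply: (pwp_mono (collectP inp lim inT sS V3 SE o0 t0 NB0 A10 A)) => // s7 [fr [NB zs mz]].
carry fr; clear fr.
apply: (pwp_step (rs := [:: rV]) (js := [::])) => // s8 fr E2.
have {E2} V4 : rg s8 rV = 2 + 2 * 0.
  by rewrite E2; case: (s7).
carry fr; clear fr.
have inF : (false, 11, 20, 7, 9) \in [:: (true, rSE, rNB, 8, 10); (false, rRE, rNA, 7, 9)] by [].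
apply: pwp_seq; apply: (pwp_mono (collectP inp lim inF sR V4 RE o0 t0 NA0 A9 A)) => // s9 [fr [_ xs mx]].
carry fr; clear fr.
apply: (@pwp_last _ _ [:: rREM; rV; rC] [::]) => // s10 fr E2.
have {E2} [V5 REM C5] : [/\ rg s10 rV = 2, rg s10 rREM = rg s10 rBE & rg s10 rC = (2 < rg s10 rRE)].
  by rewrite E2; case: (s9) z0 => g f /= ->; rewrite addn0.
carry fr; clear fr.
split; last by split.
split; rewrite ?Eys //.
- by rewrite TH' /N; lia.
- by rewrite BE M.
- by move=> y; rewrite BE -M.
- by move=> x; rewrite mx count_snd.
- by move=> z; rewrite mz count_fst.
- move=> x z x' z' /K[j _ [<- ->]] /K[j' _ [<- ->]] /mapP[t /W + ->] /mapP[t' /W + ->].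
  by move=> h h' /(key_inj h h')[-> ->].
rewrite /N; cbn [size]; lia.
Qed.

Lemma prepP (R S : relation) s0 :
  let N := size R + size S in
  let inp := fun a => nth 0 (enc_flat R S) a in
  uniq R -> uniq S -> loaded inp R S s0 ->
  pwp inp (2 * N + 2) prep (2000 * N.+1) (fun s => ready R S s /\ fresh s) s0.
Proof.
move=> N inp uR uS [n0 b0 a0 aj].
apply: (pwp_mono (Q := fun s => ready R S s /\ fresh s)); last by move=> s; apply.
apply: (pwp_step (rs := iota 3 29) (js := [::])) => // s1 fr1 E1.
have [z0 o0 t0 [SE N4 RE W0] [[J0 TH0 BE0 NA0] [NB0 ACC0 P0 Q0 [CU0 V0]]]] :
  [/\ rg s1 r0 = 0, rg s1 r1 = 1, rg s1 r2 = 2,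
    [/\ rg s1 rSE = 2 * N + 2, rg s1 rN4 = 4 * N, rg s1 rRE = 2 + 2 * size R & rg s1 rW = 0] &
    [/\ rg s1 rJ = 1, rg s1 rTH = 0, rg s1 rBE = 0 & rg s1 rNA = 0]
    /\ [/\ rg s1 rNB = 0, rg s1 rACC = 0, rg s1 rP = 0, rg s1 rQ = 0 & rg s1 rCU = 0 /\ rg s1 rV = 32]].
  rewrite {}E1; case: (s0) n0 b0 => g f /= -> ->; rewrite -/N !addnn.
  (* Only |D| and [B] = |S| + 32 |D| are left in cells 0 and 1. Doubling 4 |D| three times gives 32
     |D|, hence |S| by subtraction from [B], and then |R|. *)
  have -> : N - (size S + 32 * N - N.*2.*2.*2.*2.*2) = size R.
    by rewrite -!mul2n !mulnA addnK /N addnK.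
  by clear; do ?split=> //; lia.
have Ea : ar s1 = ar s0 by rewrite E1; case: (s0).
rewrite -Ea in a0 aj; clear E1 Ea n0 b0; carry fr1; clear fr1.
apply: pwp_seq; apply: (pwp_mono (copyP inp o0 V0 SE)) => // s2 [fr A0].
have {a0} A0' v : 1 < v < 2 * N + 2 -> ar s2 0 v = inp v.
  by move=> /andP[v1 v2]; rewrite A0 //; case: ltnP => // v3; rewrite a0 // v1 v3.
have {aj} aj j v : j \in [:: 2; 3; 4; 6; 9; 10; 11] -> ar s2 j v = 0.
  move=> hj; rewrite (proj2 fr); first by apply: aj; move: hj; rewrite !inE; lia.
  by move: hj; rewrite !inE; lia.
clear A0; carry fr; clear fr; rewrite addnC in SE.
have [sR sS] := stored_enc A0'.
by apply: digestP => // j hj v; apply: aj.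
cbn [size init]; rewrite /N; lia.
Qed.

(** * Outputs and delays of a trace *)

Definition outs (T : trace) : seq (nat * nat) := pmap id T.

(** The number of steps since the last output, or since the start if there was none. *)
Definition gap (T : trace) : nat := foldl (fun g o => if isSome o then 0 else g.+1) 0 T.

Definition ontime (d : nat) (T : trace) : Prop := forall n, gap (take n T) <= d.

Definition quietly (n : nat) (T T' : trace) : Prop :=
  exists2 j, j <= n & T' = T ++ nseq j None.

Lemma quietly_rcons T : quietly 1 T (rcons T None).
Proof. by exists 1; rewrite ?cats1. Qed.

Lemma quietly_trans n1 n2 T1 T2 T3 :
  quietly n1 T1 T2 -> quietly n2 T2 T3 -> quietly (n1 + n2) T1 T3.
Proof.
move=> [j1 h1 ->] [j2 h2 ->]; exists (j1 + j2); first exact: leq_add.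
by rewrite -catA nseqD.
Qed.

Lemma quietly_le n n' T T' : n <= n' -> quietly n T T' -> quietly n' T T'.
Proof. by move=> h [j hj ->]; exists j => //; apply: leq_trans h. Qed.

Lemma gap_nones T j : gap (T ++ nseq j None) = gap T + j.
Proof.
rewrite /gap foldl_cat; elim: j (foldl _ 0 T) => [|j IH] g /=; first by rewrite addn0.
by rewrite IH addSnnS.
Qed.

Lemma gap_out T p : gap (rcons T (Some p)) = 0.
Proof. by rewrite /gap foldl_rcons. Qed.

Lemma ontime_rcons d T o : ontime d T -> gap (rcons T o) <= d -> ontime d (rcons T o).
Proof.
move=> H h n; have [hn|hn] := leqP n (size T).
  by rewrite -cats1 takel_cat.
by rewrite take_oversize // size_rcons.
Qed.

Lemma ontime_nones d T j : ontime d T -> gap T + j <= d -> ontime d (T ++ nseq j None).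
Proof.
elim: j => [|j IH] H h; first by rewrite cats0.
have E : T ++ nseq j.+1 None = rcons (T ++ nseq j None) None.
  by rewrite -cats1 -catA -[j.+1]addn1 nseqD.
rewrite E; apply: ontime_rcons; first by apply: IH => //; lia.
by rewrite -E gap_nones.
Qed.

Lemma outs_nones T j : outs (T ++ nseq j None) = outs T.
Proof. by rewrite /outs pmap_cat; elim: j => [|j IH] //=; rewrite cats0. Qed.

Lemma outs_rcons T p : outs (rcons T (Some p)) = rcons (outs T) p.
Proof. by rewrite /outs -cats1 pmap_cat /= cats1. Qed.

Lemma outs_quietly n T T' : quietly n T T' -> outs T' = outs T.
Proof. by move=> [j _ ->]; rewrite outs_nones. Qed.

(** * Total correctness with traces *)

Section TraceTriples.
Variables (inp : nat -> nat) (lim : nat).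

(** The postcondition sees the whole past trace [T ++ t], since a delay may extend over several
    commands. *)
Definition wp (c : cmd) (Q : state -> trace -> Prop) (s : state) (T : trace) : Prop :=
  exists s' t, exec inp lim c s s' t /\ Q s' (T ++ t).

Lemma wp_seq c1 c2 Q s T : wp c1 (wp c2 Q) s T -> wp (Seq c1 c2) Q s T.
Proof.
move=> [s1 [t1 [e1 [s2 [t2 [e2 q]]]]]]; exists s2, (t1 ++ t2).
by split; [apply: ESeq e1 e2 | rewrite catA].
Qed.

Lemma wp_silent c n Q s T : silent c ->
  pwp inp lim c n (fun s' => forall T', quietly n T T' -> Q s' T') s -> wp c Q s T.
Proof.
move=> sc [s' [t [e h q]]]; exists s', t; split=> //; apply: q; exists (size t) => //.
by rewrite -(exec_silent e sc).
Qed.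

Lemma wp_step rs js l Q s T : all silent1 l -> all (writes1 rs js) l ->
  (forall s' T', frame rs js s s' -> s' = sem s l -> quietly (20 * size l) T T' -> Q s' T') ->
  wp (Blk l) Q s T.
Proof.
move=> sl w H; apply: (wp_silent (n := 20 * size l)) => //.
by apply: pwp_blk => T'; apply: H => //; apply: frame_blk.
Qed.

Lemma wp_out a b (Q : state -> trace -> Prop) s T :
  Q s (rcons T (Some (rg s a, rg s b))) -> wp (Blk [:: OOut a b]) Q s T.
Proof.
move=> q; exists s, [:: Some (rg s a, rg s b)]; rewrite cats1; split=> //.
by have := @EBlk inp lim [:: OOut a b] s; case: (s).
Qed.

Lemma wp_if r c1 c2 Q s T :
  (rg s r <> 0 -> wp c1 (fun s' T' => Q s' (rcons T' None)) s (rcons T None)) ->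
  (rg s r = 0 -> wp c2 Q s (rcons T None)) -> wp (If r c1 c2) Q s T.
Proof.
move=> h1 h2; have [e|/eqP e] := eqVneq (rg s r) 0.
- have [s' [t [e1 q]]] := h2 e; exists s', (None :: t); split; first exact: EIf0.
  by rewrite -cat_rcons.
- have [s' [t [e1 q]]] := h1 e; exists s', (None :: rcons t None); split; first exact: EIf1.
  by rewrite -cat_rcons -rcons_cat.
Qed.

Lemma wp_while0 r c (Q : state -> trace -> Prop) s T :
  rg s r = 0 -> Q s (rcons T None) -> wp (While r c) Q s T.
Proof. by move=> e q; exists s, [:: None]; rewrite cats1; split=> //; apply: EWhile0. Qed.

Lemma wp_while1 r c Q s T : rg s r <> 0 ->
  wp c (fun s' T' => wp (While r c) Q s' (rcons T' None)) s (rcons T None) ->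
  wp (While r c) Q s T.
Proof.
move=> e [s1 [t1 [e1 [s2 [t2 [e2 q]]]]]]; exists s2, (None :: rcons t1 None ++ t2).
split; first exact: EWhile1 e1 e2.
by move: q; rewrite -!cats1 -!catA.
Qed.

End TraceTriples.

(** * Code of the enumeration *)

Definition emit : cmd :=
  Seq (Blk [:: OLoad rD 7 rP; OLoad rF 8 rQ])
  (Seq (Blk [:: OOut rD rF])
  (Seq (Blk [:: OSub rREM rREM r1; OAdd rQ rQ r1; OLt rC rQ rNB])
       (If rC (Blk [::]) (Blk [:: OConst rQ 0; OAdd rP rP r1])))).

Definition tick : cmd :=
  Seq (Blk [:: OAdd rACC rACC rJ; OLt rC rACC rTH])
      (If rC (Blk [::]) (Seq emit (Blk [:: OSub rACC rACC rTH]))).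

(** The sum of the two membership bits is below 2 exactly when (x, z) is not a pair of y*. *)
Definition visit : cmd :=
  Seq (Blk [:: OLoad rD 9 rX; OLoad rF 10 rZ; OAdd rD rD rF; OLt rC rD r2])
  (If rC (Seq (Blk [:: OLoad rD 5 rX; OAdd rD rD rZ; OLoad rF 6 rD; OLt rC rF r1])
              (If rC (Seq (Blk [:: OStore 6 rD r1]) (Blk [:: OOut rX rZ])) (Blk [::])))
         (Blk [::])).

Definition walk : cmd :=
  While rPT (Seq (Blk [:: OAdd rD rPT r1; OLoad rZ 0 rD; OLoad rPT 1 rPT])
                 (Seq visit tick)).

(** A unit is also charged for each tuple of [R], because a tuple without partners in [S] takes time
    as well. *)
Definition work : cmd :=
  While rC (Seq (Blk (rcons loads (OLoad rPT 2 rY)))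
           (Seq tick (Seq walk (Blk (incr rRE))))).

Definition drain : cmd := While rREM emit.

Definition dyn_rs := [:: rV; rC; rX; rY; rZ; rD; rF; rACC; rREM; rP; rQ; rPT].

Lemma frame_sub rs js rs' js' s s' :
  all (mem rs') rs -> all (mem js') js -> frame rs js s s' -> frame rs' js' s s'.
Proof.
move=> /allP h1 /allP h2 [fa fb]; split=> x hx; [apply: fa | apply: fb].
  by apply: contra hx => /h1.
by apply: contra hx => /h2.
Qed.

Lemma ready_frame R S s s' : frame dyn_rs [:: 6] s s' -> ready R S s -> ready R S s'.
Proof.
move=> [fa fb] [h1 h2 h3 h4 h5 h6 h7 h8 h9 h10 h11 h12 h13 h14 h15 h16].
by split; rewrite ?fa ?fb.
Qed.

(** * Correctness and delay of the enumeration *)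

Section Enumeration.
Variables (inp : nat -> nat) (lim : nat) (R S : relation) (ys : nat).
Local Notation wp := (wp inp lim).
Let a := deg2 ys R.
Let b := deg1 ys S.
Let J := joinsize R S.
Let N := size R + size S.

Definition star (p : nat * nat) : bool := ((p.1, ys) \in R) && ((ys, p.2) \in S).
Let xs := [seq t.1 | t <- R & t.2 == ys].
Let zs := [seq t.2 | t <- S & t.1 == ys].
(** Row-major order on the grid of the x's and z's of the chosen join value, which is the order of
    [emit]. *)
Definition star_nth e := (nth 0 xs (e %/ b), nth 0 zs (e %% b)).
Definition star_seq := [seq star_nth e | e <- iota 0 (a * b)].

Hypotheses (uR : uniq R) (uS : uniq S) (N0 : 0 < N) (JN : J <= N ^ 2).
Hypotheses (Jstar : J ^ 2 <= N ^ 2 * (a * b)) (Jstar2 : J <= N * (a * b)).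

Lemma size_xs : size xs = a. Proof. by rewrite size_map size_filter. Qed.
Lemma size_zs : size zs = b. Proof. by rewrite size_map size_filter. Qed.

Lemma uniq_xs : uniq xs.
Proof.
rewrite map_inj_in_uniq ?filter_uniq // => -[x y] [x' y'].
by rewrite !mem_filter /= => /andP[/eqP -> _] /andP[/eqP -> _] ->.
Qed.

Lemma uniq_zs : uniq zs.
Proof.
rewrite map_inj_in_uniq ?filter_uniq // => -[x y] [x' y'].
by rewrite !mem_filter /= => /andP[/eqP -> _] /andP[/eqP -> _] ->.
Qed.

Lemma mem_xs x : (x \in xs) = ((x, ys) \in R).
Proof.
apply/mapP/idP => [[[x' y]]|h]; last by exists (x, ys); rewrite // mem_filter /= eqxx.
by rewrite mem_filter /= => /andP[/eqP -> ?] ->.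
Qed.

Lemma mem_zs z : (z \in zs) = ((ys, z) \in S).
Proof.
apply/mapP/idP => [[[y z']]|h]; last by exists (ys, z); rewrite // mem_filter /= eqxx.
by rewrite mem_filter /= => /andP[/eqP -> ?] ->.
Qed.

Lemma uniq_star : uniq star_seq.
Proof.
rewrite map_inj_in_uniq ?iota_uniq // => e e'; rewrite !mem_iota /= !add0n => he he'.
have b0 : 0 < b by case: (b) he => //; rewrite muln0.
case=> /eqP E1 /eqP E2; move: E1 E2.
rewrite !nth_uniq ?size_xs ?size_zs ?uniq_xs ?uniq_zs ?ltn_mod ?ltn_divLR //.
by move=> /eqP E1 /eqP E2; rewrite (divn_eq e b) (divn_eq e' b) E1 E2.
Qed.

Lemma mem_star p : (p \in star_seq) = star p.
Proof.
apply/mapP/andP => [[e]|[]].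
  rewrite mem_iota add0n /= => he ->.
  have b0 : 0 < b by case: (b) he => //; rewrite muln0.
  by rewrite -mem_xs -mem_zs !mem_nth ?size_xs ?size_zs ?ltn_mod ?ltn_divLR.
case: p => x z /=; rewrite -mem_xs -mem_zs => hx hz.
have ix : index x xs < a by rewrite -size_xs index_mem.
have iz : index z zs < b by rewrite -size_zs index_mem.
exists (index x xs * b + index z zs).
  by rewrite mem_iota add0n /=; nia.
have b0 : 0 < b by apply: leq_trans iz.
by rewrite /star_nth divnMDl // divn_small // modnMDl modn_small // addn0 !nth_index.
Qed.


Definition pos (s : state) : Prop :=
  [/\ rg s rREM <= a * b, rg s rP = (a * b - rg s rREM) %/ b
    & rg s rQ = (a * b - rg s rREM) %% b].

(** [h] lists the pairs visited by the walk, with repetitions. The output is made of the visited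
    pairs outside the star and an initial segment of the star; these two sources are disjoint, so
    the table need only record the first. *)
Record found (h : seq (nat * nat)) (s : state) (T : trace) : Prop := Found {
  found_ready : ready R S s;
  found_ys : rg s rYS = ys;
  found_pos : pos s;
  found_table x z : x \in map fst R -> z \in map snd S ->
    ar s 6 (ar s 5 x + z) = ((x, z) \in h) && ~~ star (x, z);
  found_uniq : uniq (outs T);
  found_mem p : (p \in outs T) =
    ((p \in h) && ~~ star p) || (p \in take (a * b - rg s rREM) star_seq)
}.

(** Conservation law of the accumulator: [u] units have put in [u * (J + 1)], and each of the
    [a * b - rREM] emissions has taken out 4 N^2. *)
Definition counted (u : nat) (s : state) : Prop :=
  (a * b - rg s rREM) * (4 * N ^ 2) + rg s rACC = u * J.+1 /\ rg s rACC < 4 * N ^ 2.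

Lemma found_frame h s s' T T' n :
  frame [:: rV; rC; rX; rY; rZ; rD; rF; rACC; rPT] [::] s s' -> quietly n T T' ->
  found h s T -> found h s' T'.
Proof.
move=> [fa fb] /outs_quietly o [h1 h2 [p1 p2 p3] h4 h5 h6].
split; rewrite ?o ?fa ?fb //; last by split; rewrite !fa.
by apply: ready_frame h1; apply: frame_sub (conj fa fb).
Qed.

Lemma counted_frame u s s' rs js : frame rs js s s' -> rREM \notin rs -> rACC \notin rs ->
  counted u s -> counted u s'.
Proof. by move=> [fa _] h1 h2; rewrite /counted !fa. Qed.

(** An accumulator below 4 N^2 allows at most 4 N^2 / (J + 1) completed units since the last output;
    the 2 stands for up to 2000 steps not yet charged to a unit. *)
Definition budget := 1000 * (4 * N ^ 2 %/ J.+1 + 2).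

(* A unit of work takes fewer than 1000 steps; [k] is the number of units since
   the last emission, each of which added [J + 1] to the accumulator. *)
Definition paced (g acc : nat) (T : trace) : Prop :=
  ontime budget T /\ exists2 k, gap T <= 1000 * k + g & k * J.+1 <= acc.

Lemma paced_quietly g acc n T T' : quietly n T T' -> acc < 4 * N ^ 2 ->
  g + n <= 2000 -> paced g acc T -> paced (g + n) acc T'.
Proof.
move=> [j jn ->] hacc gn [ot [k hk ka]].
have kd : k <= 4 * N ^ 2 %/ J.+1 by rewrite leq_divRL // (leq_trans ka) // ltnW.
split; last by exists k => //; rewrite gap_nones; lia.
by apply: ontime_nones => //; rewrite /budget; lia.
Qed.

(** After an output no unit has elapsed, so the new accumulator may be arbitrary. Outputs of the
    walk thus help the delay without touching the accumulator. *)
Lemma paced_out g acc acc' p T : paced g acc T -> paced 0 acc' (rcons T (Some p)).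
Proof.
move=> [ot _]; split; last by exists 0; rewrite ?gap_out.
by apply: ontime_rcons => //; rewrite gap_out.
Qed.

Lemma paced_unit g acc T : g <= 1000 -> paced g acc T -> paced 0 (acc + J.+1) T.
Proof.
move=> hg [ot [k hk ka]]; split=> //; exists k.+1; first lia.
by rewrite mulSn addnC leq_add2r.
Qed.

(** The carry rule by which [emit] keeps [rP] and [rQ] equal to a quotient and a remainder without
    dividing. *)
Lemma divmodS e d : 0 < d ->
  e.+1 %/ d = (if (e %% d).+1 < d then e %/ d else (e %/ d).+1) /\
  e.+1 %% d = (if (e %% d).+1 < d then (e %% d).+1 else 0).
Proof.
move=> d0; have E : e.+1 = e %/ d * d + (e %% d).+1 by rewrite addnS -divn_eq.
case: ltnP => h; first by rewrite E divnMDl // modnMDl (divn_small h) (modn_small h) addn0.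
have {}E : e.+1 = (e %/ d).+1 * d + 0.
  by rewrite E mulSn addn0 addnC; congr (_ + _); apply/eqP; rewrite eqn_leq h ltn_mod d0.
by rewrite E divnMDl // modnMDl div0n mod0n addn0.
Qed.

Lemma emitP (Q : state -> trace -> Prop) s T :
  ready R S s -> rg s rYS = ys -> pos s -> 0 < rg s rREM ->
  (forall s' T1 T', frame [:: rD; rF; rREM; rQ; rC; rP] [::] s s' ->
     rg s' rREM = (rg s rREM).-1 -> pos s' -> quietly 40 T T1 ->
     quietly 110 (rcons T1 (Some (star_nth (a * b - rg s rREM)))) T' -> Q s' T') ->
  wp emit Q s T.
Proof.
move=> rd Eys [p1 p2 p3] rem H.
set e := a * b - rg s rREM in p2 p3 H.
have he : e < a * b by rewrite /e; lia.
have b0 : 0 < b by case: (b) he => //; rewrite muln0.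
apply: wp_seq; apply: (@wp_step inp lim [:: rD; rF] [::]) => // s1 T1 fr1 E1 q1.
have [D F] : rg s1 rD = (star_nth e).1 /\ rg s1 rF = (star_nth e).2.
  have X := @ready_xs _ _ _ rd (e %/ b); have Z := @ready_zs _ _ _ rd (e %% b).
  rewrite Eys in X Z; rewrite /star_nth /= -X ?ltn_divLR // -Z ?ltn_mod //.
  by rewrite E1 -p2 -p3; case: (s).
apply: wp_seq; apply: wp_out; rewrite D F -surjective_pairing.
apply: wp_seq; apply: (@wp_step inp lim [:: rREM; rQ; rC] [::]) => // s2 T2 fr2 E2 q2.
have o1 := ready_r1 rd; have NB := ready_NB rd; rewrite Eys -/b in NB.
have e' : a * b - (rg s rREM).-1 = e.+1 by rewrite /e; lia.
have [d1 d2] := divmodS e b0.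
have REM : rg s1 rREM = rg s rREM by apply: (proj1 fr1).
carry fr1.
have [P2 Q2 C2 REM2 o2] : [/\ rg s2 rP = e %/ b, rg s2 rQ = (e %% b).+1,
    rg s2 rC = ((e %% b).+1 < b), rg s2 rREM = (rg s rREM).-1 & rg s2 r1 = 1].
  by rewrite E2; case: (s1) p2 p3 o1 NB REM => g f /= -> -> -> -> ->; rewrite addn1 subn1.
have fr : frame [:: rD; rF; rREM; rQ; rC; rP] [::] s s2.
  by apply: (@frame_trans _ _ _ s1); [apply: frame_sub fr1 | apply: frame_sub fr2].
apply: wp_if => C.
- apply: (@wp_step inp lim [::] [::]) => // s3 T3 _ -> q3; apply: (H _ T1) => //.
  + split; rewrite REM2 ?e' ?P2 ?Q2 ?d1 ?d2; last by move: C; rewrite C2; case: ifP.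
      by apply: leq_trans p1; apply: leq_pred.
    by move: C; rewrite C2; case: ifP.
  + apply: quietly_le (quietly_trans q2 (quietly_trans (quietly_rcons _) (quietly_trans q3 (quietly_rcons _)))).
    by [].
- apply: (@wp_step inp lim [:: rQ; rP] [::]) => // s3 T3 fr3 E3 q3.
  have [P3 Q3 REM3] : [/\ rg s3 rP = (e %/ b).+1, rg s3 rQ = 0 & rg s3 rREM = (rg s rREM).-1].
    by rewrite E3; case: (s2) P2 o2 REM2 => g f /= -> -> ->; rewrite addn1.
  apply: (H _ T1) => //.
  + by apply: (@frame_trans _ _ _ s2) => //; apply: frame_sub fr3.
  + split; rewrite REM3 ?e' ?P3 ?Q3 ?d1 ?d2; last by move: C; rewrite C2; case: ifP.
      by apply: leq_trans p1; apply: leq_pred.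
    by move: C; rewrite C2; case: ifP.
  + by apply: quietly_le (quietly_trans q2 (quietly_trans (quietly_rcons _) q3)).
Qed.

Lemma take_star e : e < a * b -> take e.+1 star_seq = rcons (take e star_seq) (star_nth e).
Proof.
move=> he; rewrite (take_nth (0, 0)) ?size_map ?size_iota //.
by rewrite (nth_map 0) ?size_iota // nth_iota.
Qed.

(* The emitted pair is new: the pairs found by the walk are not in the star. *)
Lemma found_emit h s T s' T1 T' n n' :
  found h s T -> 0 < rg s rREM -> frame [:: rC; rD; rF; rREM; rQ; rP; rACC] [::] s s' ->
  rg s' rREM = (rg s rREM).-1 -> pos s' -> quietly n T T1 ->
  quietly n' (rcons T1 (Some (star_nth (a * b - rg s rREM)))) T' -> found h s' T'.
Proof.
move=> [h1 h2 [p1 p2 p3] h4 h5 h6] rem [fa fb] REM ps /outs_quietly o1 /outs_quietly o2.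
set e := a * b - rg s rREM in p2 p3 h6 o2.
have he : e < a * b by rewrite /e; lia.
have e' : a * b - rg s' rREM = e.+1 by rewrite REM /e; lia.
have o3 : outs T' = rcons (outs T) (star_nth e) by rewrite o2 outs_rcons o1.
have st : star (star_nth e).
  by rewrite -mem_star; apply: map_f; rewrite mem_iota.
split=> //.
- apply: ready_frame h1; apply: frame_sub (conj fa fb) => //.
- by rewrite fa.
- by move=> x z hx hz; rewrite !fb // h4.
- rewrite o3 rcons_uniq h5 andbT h6 st andbF /=.
  by have := take_uniq e.+1 uniq_star; rewrite take_star // rcons_uniq => /andP[].
- move=> p; rewrite o3 e' take_star // !mem_rcons !inE h6.
  by case: (p == _); rewrite //= orbT.
Qed.

Lemma paced_le g g' acc T : g <= g' -> paced g acc T -> paced g' acc T.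
Proof. by move=> h [ot [k hk ka]]; split=> //; exists k => //; lia. Qed.

(* [u * (J + 1)] bounds the accumulator plus all emissions already made, hence
   the threshold is never reached when no pair of the star is left. *)
Lemma budget_emit u : u <= size R + J -> u * J.+1 < 4 * N ^ 2 * (a * b).+1.
Proof.
move=> hu; have N1 : size R <= N by apply: leq_addr.
apply: (@leq_ltn_trans ((N + J) * J.+1)); first by rewrite leq_mul2r; apply/orP; right; lia.
move: (a * b) Jstar Jstar2 N0 => p; move: J N => j m; rewrite -!mulnn => h1 h2 m0.
(* Of the four terms of (N + J)(J + 1), the terms N J, J^2 and J are at most N^2 p and N is at most
   N^2. This is the origin of the factor 4. *)
have : m * j <= m * m * p by rewrite -mulnA leq_mul2l h2 orbT.
have : m * p <= m * m * p by rewrite leq_mul2r leq_pmull ?orbT.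
have : m <= m * m by rewrite leq_pmull.
by rewrite mulnDl !mulnS; lia.
Qed.

Lemma tickP (Q : state -> trace -> Prop) h u s T g :
  found h s T -> counted u s -> u < size R + J -> paced g (rg s rACC) T -> g <= 700 ->
  (forall s' T', frame [:: rC; rD; rF; rREM; rQ; rP; rACC] [::] s s' ->
     found h s' T' -> counted u.+1 s' -> paced 300 (rg s' rACC) T' -> Q s' T') ->
  wp tick Q s T.
Proof.
move=> fo [c1 c2] hu pc hg H.
have rd := found_ready fo; have J1 := ready_J rd; have TH := ready_TH rd.
rewrite -/J in J1; rewrite -/N in TH.
apply: wp_seq; apply: (@wp_step inp lim [:: rACC; rC] [::]) => // s1 T1 fr1 E1 q1.
have [A1 C1] : rg s1 rACC = rg s rACC + J.+1 /\ rg s1 rC = (rg s rACC + J.+1 < 4 * N ^ 2).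
  by rewrite E1; case: (s) J1 TH => g' f /= -> ->.
have fo1 : found h s1 T1 by apply: found_frame fo => //; [apply: frame_sub fr1 | apply: q1].
have REM1 : rg s1 rREM = rg s rREM by apply: (proj1 fr1).
have TH1 : rg s1 rTH = 4 * N ^ 2 by rewrite -TH; apply: (proj1 fr1).
have fr1' : frame [:: rC; rD; rF; rREM; rQ; rP; rACC] [::] s s1 by apply: frame_sub fr1.
apply: wp_if => C.
- apply: (@wp_step inp lim [::] [::]) => // s2 T2 _ -> q2.
  have q : quietly 50 T (rcons T2 None).
    by apply: quietly_le (quietly_trans q1 (quietly_trans (quietly_rcons _) (quietly_trans q2 (quietly_rcons _)))).
  apply: H => //.
  + by apply: found_frame fo; [apply: frame_sub fr1 | apply: q].
  + split; first by rewrite REM1 A1 addnA c1 mulSn addnC.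
    by rewrite A1; move: C; rewrite C1; case: ltnP.
  + rewrite A1; apply: (@paced_le 0) => //.
    by apply: (@paced_unit (g + 50)); [lia | apply: paced_quietly q _ _ pc; [|lia]].
have {}C : 4 * N ^ 2 <= rg s rACC + J.+1 by move: C; rewrite C1; case: ltnP.
(* If all [a * b] pairs were gone, the units would have put in a further 4 N^2 beyond these
   emissions, against [budget_emit]. *)
have rem : 0 < rg s rREM.
  have := budget_emit hu; rewrite lt0n => hb; apply/eqP => r0.
  by move: hb; rewrite mulSn -c1 r0 subn0 [_ * (a * b).+1]mulnS mulnC; lia.
apply: wp_seq; apply: emitP (found_ready fo1) (found_ys fo1) (found_pos fo1) _ _; first by rewrite REM1.
rewrite REM1 => s2 T2 T3 fr2 REM2 ps2 q2 q3.
apply: (@wp_step inp lim [:: rACC] [::]) => // s3 T4 fr3 E3 q4.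
have fr : frame [:: rC; rD; rF; rREM; rQ; rP; rACC] [::] s s3.
  by apply: frame_trans fr1' (@frame_trans _ _ _ s2 _ _ _); [apply: frame_sub fr2 | apply: frame_sub fr3].
have A3 : rg s3 rACC = rg s rACC + J.+1 - 4 * N ^ 2.
  have := proj1 fr2 rTH isT; have := proj1 fr2 rACC isT.
  by rewrite E3 A1 TH1; case: (s2) => g' f /= -> ->.
(* By [JN] the increment [J + 1] does not exceed the threshold, so a single subtraction brings the
   accumulator back below it. *)
have lt : rg s3 rACC < 4 * N ^ 2.
  have : 0 < N ^ 2 by rewrite expn_gt0 N0.
  by rewrite A3; move: JN c2 C; move: (N ^ 2); lia.
have q5 : quietly 81 T T2.
  by apply: quietly_le (quietly_trans q1 (quietly_trans (quietly_rcons _) q2)).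
have q6 : quietly 150 (rcons T2 (Some (star_nth (a * b - rg s rREM)))) T4.
  by apply: quietly_le (quietly_trans q3 q4).
have REM3 : rg s3 rREM = (rg s rREM).-1 by rewrite (proj1 fr3).
apply: H => //.
- apply: (found_emit (T1 := T2) (T' := T4)) q5 q6 => //.
  by case: ps2 => p1 p2 p3; split; rewrite !(proj1 fr3).
- split=> //; have [hr _ _] := found_pos fo; rewrite A3 REM3 [u.+1 * _]mulSn -c1.
  have -> : a * b - (rg s rREM).-1 = (a * b - rg s rREM).+1 by move: rem hr; lia.
  by move: C; rewrite mulSnr; move: (4 * N ^ 2) (_ * _); lia.
- apply: (@paced_le (0 + 150)) => //; apply: paced_quietly q6 lt _ _ => //.
  by apply: paced_out (paced_quietly q5 c2 _ pc); lia.
Qed.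

Lemma visitP (Q : state -> trace -> Prop) h s T g x z :
  found h s T -> rg s rACC < 4 * N ^ 2 -> paced g (rg s rACC) T -> g <= 1000 ->
  rg s rX = x -> rg s rZ = z -> x \in map fst R -> z \in map snd S ->
  (forall s' T', frame [:: rD; rF; rC] [:: 6] s s' -> found (rcons h (x, z)) s' T' ->
     paced (g + 250) (rg s' rACC) T' -> Q s' T') ->
  wp visit Q s T.
Proof.
move=> fo c2 pc hg X Z xR zS H; have rd := found_ready fo; have ys0 := found_ys fo.
apply: wp_seq; apply: (@wp_step inp lim [:: rD; rF; rC] [::]) => // s1 T1 fr1 E1 q1.
have C1 : rg s1 rC = ~~ star (x, z).
  rewrite E1; move: (ready_mx rd x) (ready_mz rd z) (ready_r2 rd); rewrite ys0 /star /=.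
  case: (s) X Z => g' f /= -> -> -> -> ->.
  by case: (_ \in R); case: (_ \in S).
(* Common end of the two branches that write nothing: a pair of the star, or one already in [h],
   does not change the invariant. *)
have stay s' T' : frame [:: rD; rF; rC] [::] s s' -> quietly 200 T T' ->
    star (x, z) || ((x, z) \in h) -> Q s' T'.
  move=> fr q sh; have fo' : found h s' T' by apply: found_frame q fo; apply: frame_sub fr.
  have E p : (p \in rcons h (x, z)) && ~~ star p = (p \in h) && ~~ star p.
    rewrite mem_rcons inE; case: eqP => [->|_] //=.
    by case/orP: sh => ->; rewrite ?andbF.
  apply: H; first by apply: frame_sub fr.
    by case: fo' => h1 h2 h3 h4 h5 h6; split=> // [x' z' hx hz|p]; rewrite E ?h4 ?h6.
  rewrite (proj1 fr) //; apply: (@paced_le (g + 200)); first by clear; lia.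
  by apply: paced_quietly q _ _ pc => //; move: hg; clear; lia.
apply: wp_if; rewrite C1; case st: (star (x, z)) => //= _; last first.
  apply: (@wp_step inp lim [::] [::]) => // s2 T2 _ -> q2; apply: stay => //; last by rewrite st.
  by apply: quietly_le (quietly_trans q1 (quietly_trans (quietly_rcons _) q2)).
apply: wp_seq; apply: (@wp_step inp lim [:: rD; rF; rC] [::]) => // s2 T2 fr2 E2 q2.
have fr : frame [:: rD; rF; rC] [::] s s2 := frame_trans fr1 fr2.
have [D2 C2] : rg s2 rD = ar s 5 x + z /\ rg s2 rC = ((x, z) \notin h).
  have e5 : ar s1 5 = ar s 5 by apply: (proj2 fr1).
  have e6 : ar s1 6 = ar s 6 by apply: (proj2 fr1).
  have eX : rg s1 rX = x by rewrite (proj1 fr1).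
  have eZ : rg s1 rZ = z by rewrite (proj1 fr1).
  have e1 : rg s1 r1 = 1 by rewrite (proj1 fr1) // (ready_r1 rd).
  have := found_table fo xR zS; rewrite st andbT -e5 -e6 E2.
  case: (s1) eX eZ e1 => g' f /= -> -> -> ->; split=> //.
  by case: (_ \in h).
apply: wp_if; rewrite C2; case hh: ((x, z) \in h) => //= _; last first.
  apply: (@wp_step inp lim [::] [::]) => // s3 T3 _ -> q3; apply: stay => //.
    apply: quietly_le (quietly_trans q1 (quietly_trans (quietly_rcons _) (quietly_trans q2
      (quietly_trans (quietly_rcons _) (quietly_trans q3 (quietly_rcons _)))))).
    by [].
  by rewrite hh orbT.
apply: wp_seq; apply: (@wp_step inp lim [::] [:: 6]) => // s3 T3 fr3 E3 q3.
apply: wp_out; rewrite (proj1 fr3) // (proj1 fr) // X (proj1 fr3) // (proj1 fr) // Z.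
have fr' : frame [:: rD; rF; rC] [:: 6] s s3.
  by apply: (@frame_trans _ _ _ s2); [apply: frame_sub fr | apply: frame_sub fr3].
have q : quietly 190 T T3.
  by apply: quietly_le (quietly_trans q1 (quietly_trans (quietly_rcons _) (quietly_trans q2
      (quietly_trans (quietly_rcons _) q3)))).
have o2 : outs (rcons (rcons (rcons T3 (Some (x, z))) None) None) = rcons (outs T) (x, z).
  by rewrite !(outs_quietly (quietly_rcons _)) outs_rcons (outs_quietly q).
case: fo => h1 h2 [p1 p2 p3] h4 h5 h6.
apply: H => //.
- split.
  + by apply: ready_frame h1; apply: frame_sub fr'.
  + by rewrite (proj1 fr').
  + by split; rewrite !(proj1 fr').
  + move=> x' z' hx hz; rewrite (proj2 fr' 5) // mem_rcons inE.
    have -> : ar s3 6 (ar s 5 x' + z') =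
        if ar s 5 x' + z' == ar s 5 x + z then 1 else ar s 6 (ar s 5 x' + z').
      have e6 : ar s2 6 = ar s 6 by apply: (proj2 fr).
      have e1 : rg s2 r1 = 1 by rewrite (proj1 fr) // (ready_r1 rd).
      by rewrite E3 -e6; case: (s2) D2 e1 => g' f /= -> ->.
    (* Keys being injective, the store marks (x, z) and no other pair. *)
    case: eqP => [/(ready_key rd hx xR hz zS)[-> ->]|ne]; first by rewrite eqxx st.
    rewrite h4 //; case: eqP => //= -[E1' E2']; by case: ne; rewrite E1' E2'.
  + rewrite o2 rcons_uniq h5 andbT h6 hh /= -/star_seq.
    by apply: contraFN st => /mem_take; rewrite mem_star.
  + move=> p; rewrite o2 !mem_rcons !inE h6 (proj1 fr') //.
    by case: eqP => [->|] //=; rewrite st.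
- rewrite (proj1 fr') //; apply: (@paced_le (0 + 2)) => //; first by clear; lia.
  apply: (paced_quietly (T := rcons T3 (Some (x, z)))) => //.
    by exists 2 => //; rewrite -!cats1 -catA.
  by apply: paced_out (paced_quietly q _ _ pc) => //; move: hg; clear; lia.
Qed.

(** Steps of one iteration: the 310 pending ones grow by 70 for the block and 250 for [visit],
    within the 700 that [tickP] admits; the tick closes the unit and leaves 300. *)
Lemma walkP (Q : state -> trace -> Prop) l : forall h u s T x B,
  found h s T -> counted u s -> u + size l <= size R + J -> paced 310 (rg s rACC) T ->
  chain (ar s 1) (ar s 0) B (rg s rPT) l -> rg s rX = x -> x \in map fst R ->
  {subset l <= map snd S} ->
  (forall s' T', frame [:: rPT; rZ; rC; rD; rF; rREM; rQ; rP; rACC] [:: 6] s s' ->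
     found (h ++ [seq (x, z) | z <- l]) s' T' -> counted (u + size l) s' ->
     paced 320 (rg s' rACC) T' -> Q s' T') ->
  wp walk Q s T.
Proof.
elim: l => [|z l IH] h u s T x B fo co hu pc ch X xR lS H; have [_ c2] := co.
  have q := quietly_rcons T.
  apply: wp_while0 => //; apply: H => //; rewrite ?cats0 ?addn0 //.
    by apply: found_frame q fo; apply: frame_refl.
  by apply: (@paced_le (310 + 1)) => //; apply: paced_quietly q _ _ pc.
case: ch => pt0 Z ch.
apply: wp_while1; first by move: pt0; case: (rg s rPT).
apply: wp_seq; apply: (@wp_step inp lim [:: rD; rZ; rPT] [::]) => // s1 T1 fr1 E1 q1.
have [PT1 Z1] : rg s1 rPT = ar s 1 (rg s rPT) /\ rg s1 rZ = z.
  rewrite E1; move: Z (ready_r1 (found_ready fo)).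
  by case: (s) => g f /= <- ->; rewrite addn1.
have q : quietly 70 T T1 by apply: quietly_le (quietly_trans (quietly_rcons _) q1).
have fo1 : found h s1 T1 by apply: found_frame q fo; apply: frame_sub fr1.
have A1 : rg s1 rACC = rg s rACC by apply: (proj1 fr1).
have X1 : rg s1 rX = x by rewrite (proj1 fr1).
have zS : z \in map snd S by apply: lS; rewrite inE eqxx.
apply: wp_seq; apply: (visitP (g := 380) fo1 _ _ _ X1 Z1 xR zS) => //.
- by rewrite A1.
- by rewrite A1; apply: (@paced_le (310 + 70)) => //; apply: paced_quietly q _ _ pc.
move=> s2 T2 fr2 fo2 pc2.
apply: (tickP (g := 650) fo2 (u := u)) => //; last 1 first.
- move=> s3 T3 fr3 fo3 co3 pc3; have [_ lt3] := co3; have q3 := quietly_rcons T3.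
  have fr : frame [:: rPT; rZ; rC; rD; rF; rREM; rQ; rP; rACC] [:: 6] s s3.
    apply: (@frame_trans _ _ _ s1); first by apply: frame_sub fr1.
    by apply: (@frame_trans _ _ _ s2); [apply: frame_sub fr2 | apply: frame_sub fr3].
  apply: (IH (rcons h (x, z)) u.+1 _ _ x B) => //.
  + by apply: found_frame q3 fo3; apply: frame_refl.
  + by move: hu; rewrite /= addSnnS.
  + by apply: (@paced_le (300 + 1)) => //; apply: paced_quietly q3 _ _ pc3.
  + rewrite !(proj2 fr) // (proj1 fr3) // (proj1 fr2) // PT1; exact: ch.
  + by rewrite (proj1 fr).
  + by move=> y yl; apply: lS; rewrite inE yl orbT.
  + move=> s' T' fr' fo' co' pc'; apply: H => //.
    * exact: frame_trans fr fr'.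
    * by move: fo'; rewrite cat_rcons.
    * by move: co'; rewrite addSnnS.
- by apply: counted_frame fr2 _ _ _ => //; apply: counted_frame fr1 _ _ _.
- by move: hu => /=; rewrite addnS; apply: leq_trans; rewrite ltnS leq_addr.
- by apply: paced_le pc2.
Qed.

Definition history (L : relation) : seq (nat * nat) :=
  flatten [seq [seq (t.1, z) | z <- slist t.2 S] | t <- L].

Lemma size_slist y : size (slist y S) = deg1 y S.
Proof. by rewrite size_map size_filter count_rev. Qed.

(** For [R] itself the sum is J, so the walk has |R| + J units. *)
Lemma size_history L : size (history L) = \sum_(t <- L) deg1 t.2 S.
Proof.
elim: L => [|t L IH]; first by rewrite big_nil.
by rewrite big_cons -IH /history /= size_cat size_map size_slist.
Qed.

Lemma history_rcons L t :
  history (rcons L t) = history L ++ [seq (t.1, z) | z <- slist t.2 S].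
Proof. by rewrite /history map_rcons flatten_rcons. Qed.

Lemma workP (Q : state -> trace -> Prop) L : forall L0 s T,
  R = L0 ++ L -> rg s rV = 2 + 2 * size L0 -> rg s rC = (size L0 < size R) ->
  found (history L0) s T -> counted (size L0 + size (history L0)) s ->
  paced 400 (rg s rACC) T ->
  (forall s' T', found (history R) s' T' -> ontime budget T' -> gap T' <= budget ->
     Q s' T') ->
  wp work Q s T.
Proof.
elim: L => [|t L IH] L0 s T ER V C fo co pc H; have [_ c2] := co.
  have q := quietly_rcons T; rewrite cats0 in ER.
  apply: wp_while0; first by rewrite C ER ltnn.
  have [ot _] := paced_quietly q c2 (isT : 400 + 1 <= 2000) pc.
  apply: H => //; last by have := ot (size T).+1; rewrite take_oversize ?size_rcons.
  by rewrite ER; apply: found_frame q fo; apply: frame_refl.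
have rd := found_ready fo.
have szR : size R = size L0 + (size L).+1 by rewrite ER size_cat.
apply: wp_while1; first by rewrite C szR -[X in X < _]addn0 ltn_add2l.
apply: wp_seq; apply: (@wp_step inp lim [:: rX; rD; rY; rPT] [::]) => // s1 T1 fr1 E1 q1.
have tn : nth (0, 0) R (size L0) = t by rewrite ER nth_cat ltnn subnn.
have [X1 PT1] : rg s1 rX = t.1 /\ rg s1 rPT = ar s 2 t.2.
  have [|] := ready_R rd (i := size L0); first by rewrite szR; lia.
  rewrite add0n tn E1 => <- <-; move: V (ready_r1 rd).
  by case: (s) => g f /= -> ->; rewrite addnAC.
have q : quietly 100 T T1 by apply: quietly_le (quietly_trans (quietly_rcons _) q1).
have fo1 : found (history L0) s1 T1 by apply: found_frame q fo; apply: frame_sub fr1.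
have A1 : rg s1 rACC = rg s rACC by apply: (proj1 fr1).
have hJ : size L0 + size (history L0) + 1 + size (slist t.2 S) <= size R + J.
  rewrite size_history size_slist /J /joinsize szR ER big_cat big_cons /=.
  by move: (\sum_(i <- L0) _) (\sum_(i <- L) _) (deg1 _ _) => *; lia.
apply: wp_seq; apply: (tickP (g := 500) fo1 (u := size L0 + size (history L0))) => //.
- exact: counted_frame fr1 _ _ co.
- by lia.
- by rewrite A1; apply: (@paced_le (400 + 100)) => //; apply: paced_quietly q _ _ pc.
move=> s2 T2 fr2 fo2 co2 pc2.
have fr : frame [:: rX; rD; rY; rPT; rC; rF; rREM; rQ; rP; rACC] [::] s s2.
  by apply: (@frame_trans _ _ _ s1); [apply: frame_sub fr1 | apply: frame_sub fr2].
apply: wp_seq; apply: (walkP (l := slist t.2 S) (x := t.1) (B := 2 + 2 * (size R + size S)) fo2 co2).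
- by move: hJ; rewrite addn1.
- by apply: paced_le pc2.
- rewrite !(proj2 fr) // (proj1 fr2) // PT1; exact: ready_chain rd t.2.
- by rewrite (proj1 fr2).
- by rewrite ER map_cat mem_cat /= inE eqxx orbT.
- move=> z /mapP[t' + ->]; rewrite mem_filter mem_rev => /andP[_ h]; exact: map_f.
move=> s3 T3 fr3 fo3 co3 pc3.
apply: (@wp_step inp lim [:: rV; rC] [::]) => // s4 T4 fr4 E4 q4.
have q' : quietly 50 T3 (rcons T4 None) by apply: quietly_le (quietly_trans q4 (quietly_rcons _)).
have [_ c3] := co3.
apply: (IH (rcons L0 t)) => //.
- by rewrite cat_rcons.
- rewrite E4 size_rcons; have := proj1 fr3 rV isT; have := proj1 fr3 r2 isT.
  rewrite !(proj1 fr) // V (ready_r2 rd); case: (s3) => g f /= -> ->; lia.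
- rewrite E4 size_rcons; have := proj1 fr3 rV isT; have := proj1 fr3 r2 isT; have := proj1 fr3 rRE isT.
  rewrite !(proj1 fr) // V (ready_r2 rd) (ready_RE rd); case: (s3) => g f /= -> -> ->.
  by congr nat_of_bool; lia.
- by rewrite history_rcons; apply: found_frame q' fo3; apply: frame_sub fr4.
- apply: (counted_frame fr4) => //; rewrite history_rcons size_rcons size_cat size_map.
  by move: co3; rewrite !addSn addnA.
- rewrite (proj1 fr4) //; apply: (@paced_le (320 + 50)) => //.
  exact: paced_quietly q' _ _ pc3.
Qed.

Lemma ontime_quietly d n T T' : quietly n T T' -> gap T + n <= d -> ontime d T -> ontime d T'.
Proof. by move=> [j jn ->] h ot; apply: ontime_nones => //; apply: leq_trans h; rewrite leq_add2l. Qed.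

Lemma gap_quietly n T T' : quietly n T T' -> gap T' <= gap T + n.
Proof. by move=> [j jn ->]; rewrite gap_nones leq_add2l. Qed.

(** The gap inherited from the walk may fill [budget], and the first output comes at most 41 steps
    later; hence the extra 50. *)
Lemma drainP (Q : state -> trace -> Prop) n : forall h s T,
  rg s rREM = n -> found h s T -> ontime (budget + 50) T -> gap T <= budget ->
  (forall s' T', found h s' T' -> rg s' rREM = 0 -> ontime (budget + 50) T' -> Q s' T') ->
  wp drain Q s T.
Proof.
have b2 : 2000 <= budget by rewrite /budget mulnDr leq_addl.
elim: n => [|n IH] h s T REM fo ot gp H.
  have q := quietly_rcons T; apply: wp_while0 => //; apply: H => //.
    by apply: found_frame q fo; apply: frame_refl.
  by apply: ontime_quietly q _ ot; lia.
apply: wp_while1; first by rewrite REM.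
have q := quietly_rcons T.
apply: (emitP (found_ready fo) (found_ys fo) (found_pos fo)); first by rewrite REM.
move=> s' T1 T' fr REM' ps q1 q2.
have qq1 := quietly_trans q q1; have qq2 := quietly_trans q2 (quietly_rcons _).
have ot1 := ontime_quietly qq1 (leq_add gp (isT : 41 <= 50)) ot.
apply: (IH h) => //.
- by rewrite REM' REM.
- apply: (found_emit (s := s)) qq1 qq2 => //; first by rewrite REM.
  by apply: frame_sub fr.
- apply: (ontime_quietly qq2); rewrite ?gap_out; first lia.
  by apply: ontime_rcons => //; rewrite gap_out.
- by apply: leq_trans (gap_quietly qq2) _; rewrite gap_out; lia.
Qed.

Lemma historyE p : (p \in history R) = (p \in two_path R S).
Proof.
rewrite /two_path mem_undup.
apply/flatten_mapP/allpairsPdep => [[t tR /mapP[z]]|[t [s [tR sS ->]]]].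
- rewrite /slist => /mapP[u]; rewrite mem_filter mem_rev => /andP[/eqP e uS' ->] ->.
  by exists t, u; split=> //; rewrite mem_filter e eqxx.
- move: sS; rewrite mem_filter => /andP[/eqP e sS]; exists t => //.
  by apply: map_f; apply/mapP; exists s => //; rewrite mem_filter e eqxx mem_rev.
Qed.

Lemma star_two_path p : star p -> p \in two_path R S.
Proof.
case: p => x z /andP[/= hx hz]; rewrite /two_path mem_undup.
by apply/allpairsPdep; exists (x, ys), (ys, z); rewrite mem_filter eqxx hx hz.
Qed.

Lemma found_all s T : found (history R) s T -> rg s rREM = 0 -> perm_eq (outs T) (two_path R S).
Proof.
move=> fo r0; apply: uniq_perm; [exact: found_uniq fo | exact: undup_uniq |] => p.
rewrite (found_mem fo) r0 subn0 take_oversize ?size_map ?size_iota // historyE mem_star.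
by case st: (star p); rewrite ?andbT ?orbF // orbT star_two_path.
Qed.

(** The initial trace [[:: None]] is the step of [IEndPre], from which the first delay is
    measured. *)
Lemma mainP s : ready R S s -> rg s rYS = ys -> fresh s ->
  wp (Seq work drain) (fun _ T => perm_eq (outs T) (two_path R S) /\ ontime (budget + 50) T)
    s [:: None].
Proof.
move=> rd eys [f6 acc rem [p0 q0] [v C]].
rewrite (ready_RE rd) -[X in X < _]addn0 ltn_add2l muln_gt0 /= in C.
have rem' : rg s rREM = a * b by rewrite rem (ready_best rd) eys.
apply: wp_seq; apply: (workP (L := R) (L0 := [::])) => //.
- split=> //; first by split; rewrite rem' ?subnn ?p0 ?q0 ?div0n ?mod0n.
  by move=> p; rewrite rem' subnn take0.
- split; first by rewrite rem' acc subnn.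
  by rewrite acc muln_gt0 expn_gt0 N0.
- have b2 : 0 < budget by rewrite /budget mulnDr addn_gt0 orbT.
  by split; [move=> [|[|n]] | exists 0].
move=> s' T' fo ot gp; apply: (drainP (n := rg s' rREM) (h := history R)) => //.
  by move=> n; apply: leq_trans (ot n) (leq_addr _ _).
by move=> s'' T'' fo' r0 ot'; split=> //; apply: found_all fo' r0.
Qed.

End Enumeration.

(** * Inequalities between join size and degrees *)

Lemma sum_sqr_bound (A B : nat -> nat) p ys : (forall y, A y * B y <= p) ->
  (\sum_(y <- ys) A y * B y) ^ 2 <= p * (\sum_(y <- ys) (A y + B y)) ^ 2.
Proof.
move=> h; elim: ys => [|y ys IH]; first by rewrite !big_nil.
rewrite !big_cons; move: (\sum_(j <- ys) _) (\sum_(j <- ys) _) IH => n j IH.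
(* One factor [A y * B y] is at most [p], the other at most the square of [A y + B y]. *)
have xx : (A y * B y) ^ 2 <= p * (A y + B y) ^ 2.
  rewrite -mulnn; apply: leq_mul (h y) _; nia.
(* The cross term is bounded through its square, the product of the two diagonal bounds; this
   replaces the square roots of Cauchy-Schwarz. *)
have : (j * (A y * B y)) ^ 2 <= (p * (n * (A y + B y))) ^ 2.
  by have := leq_mul IH xx; rewrite -!expnMn; rewrite mulnACA mulnn -!expnMn.
rewrite leq_sqr; move: IH xx; move: (A y * B y) (A y + B y) => x z IH xx cross.
rewrite !sqrnD (_ : p * _ = p * z ^ 2 + p * n ^ 2 + 2 * (p * (n * z))).
  by rewrite [x * j]mulnC !leq_add // leq_mul2l cross.
by rewrite !mulnDr [z * n]mulnC; move: (p * _) (p * _) (p * _); lia.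
Qed.

Lemma sum_fiber (L : relation) (f : nat -> nat) :
  \sum_(t <- L) f t.2 = \sum_(y <- undup (map snd L)) deg2 y L * f y.
Proof.
rewrite -(big_map snd xpredT f) -big_undup_iterop_count; apply: eq_bigr => y _.
by rewrite Monoid.iteropE iter_addn_0 mulnC /deg2 count_map.
Qed.

Lemma sum_deg1 (L : relation) ys : uniq ys -> \sum_(y <- ys) deg1 y L <= size L.
Proof.
move=> u; elim: L => [|t L IH]; first by rewrite big1.
have E : \sum_(y <- ys) (t.1 == y) = count_mem t.1 ys.
  by rewrite -sum1_count [RHS]big_mkcond; apply: eq_bigr => y _; rewrite /= eq_sym; case: eqP.
rewrite big_split /= E -add1n leq_add //.
by rewrite count_uniq_mem // leq_b1.
Qed.

Lemma joinsize_sqr (R S : relation) p : (forall y, deg2 y R * deg1 y S <= p) ->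
  joinsize R S ^ 2 <= (size R + size S) ^ 2 * p.
Proof.
move=> h; rewrite /joinsize (sum_fiber R (fun y => deg1 y S)) mulnC; apply: leq_trans (sum_sqr_bound _ h) _.
rewrite leq_mul2l leq_sqr big_split /=; apply/orP; right; apply: leq_add; last first.
  by apply: sum_deg1; apply: undup_uniq.
have := sum_fiber R (fun=> 1); rewrite sum1_size => ->.
by apply: leq_sum => y _; rewrite muln1.
Qed.

(** A tuple of [R] with join value y witnesses a_y >= 1, so it contributes b_y <= a_y b_y <= p. *)
Lemma joinsize_star (R S : relation) p : (forall y, deg2 y R * deg1 y S <= p) ->
  joinsize R S <= (size R + size S) * p.
Proof.
move=> h; apply: (@leq_trans (size R * p)); last by rewrite leq_mul2r leq_addr orbT.
rewrite /joinsize -sum1_size big_distrl /= big_seq [X in _ <= X]big_seq.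
apply: leq_sum => t tR; rewrite mul1n; apply: leq_trans (h t.2).
by rewrite leq_pmull // -has_count; apply/hasP; exists t.
Qed.

Lemma joinsize_le (R S : relation) : joinsize R S <= (size R + size S) ^ 2.
Proof.
apply: (@leq_trans (size R * size S)).
  rewrite /joinsize -sum1_size big_distrl /=; apply: leq_sum => t _.
  by rewrite mul1n count_size.
by rewrite -mulnn leq_mul ?leq_addr ?leq_addl.
Qed.

(** The delay is proved in terms of J, and a larger J only shortens it; hence the direction of the
    inequality. *)
Lemma full_join_le (R S : relation) : size (full_join R S) <= joinsize R S.
Proof.
apply: leq_trans (size_undup _) _; rewrite /joinsize size_allpairs_dep.
rewrite sumnE big_map; apply: leq_sum => t _.
by rewrite size_filter.
Qed.

(** * From traces to the enumeration predicate *)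

Lemma ontime_window d T i : ontime d T -> i <= size T ->
  exists i', i <= i' <= i + d.+1 /\ ((i' == size T) || (nth None T i' != None)).
Proof.
move=> ot iT; have [h|h] := leqP (size T) (i + d.+1).
  by exists (size T); rewrite iT h eqxx.
have [/hasP[o]|nh] := boolP (has isSome (take d.+1 (drop i T))).
  move=> /(nthP None)[j]; rewrite size_take size_drop => hj <-.
  have jd : j < d.+1 by move: hj; case: ifP => // /negbT; rewrite -leqNgt => h1 h2; apply: leq_trans h1.
  rewrite nth_take // nth_drop => so; exists (i + j); split; first by rewrite leq_addr leq_add2l ltnW.
  by apply/orP; right; case: (nth _ _ _) so.
(* Without an output among the [d + 1] steps from [i] on, the prefix ending there would have a gap
   larger than [d]. *)
have := ot (i + d.+1); rewrite takeD.
have -> : take d.+1 (drop i T) = nseq d.+1 None.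
  apply: (@eq_from_nth _ None) => [|j].
    by rewrite size_take size_nseq size_drop ifT // ltn_subRL.
  rewrite size_take size_drop => hj; rewrite nth_nseq.
  have jd : j < d.+1 by move: hj; case: ifP => // /negbT; rewrite -leqNgt => h1 h2; apply: leq_trans h1.
  rewrite jd; move: nh => /hasPn/(_ (nth None (take d.+1 (drop i T)) j)).
  rewrite mem_nth ?size_take ?size_drop // => /(_ isT).
  by case: (nth _ _ _).
by rewrite gap_nones addnS ltnNge leq_addl.
Qed.

Section Runs.
Variable P : program.

Lemma runs_nth cf t cf' : runs P cf t cf' ->
  (forall i, i < size t -> [/\ ~~ is_halt (cur_instr P (iter i (step P) cf)),
     ~~ is_endpre (cur_instr P (iter i (step P) cf))
     & obs P (iter i (step P) cf) = nth None t i]) /\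
  iter (size t) (step P) cf = cf'.
Proof.
elim: t cf => [|o t IH] cf /=; first by move=> ->.
move=> [h1 h2 h3 /IH[h4 h5]]; split; last by rewrite -iterS iterSr.
by move=> [|i] //= hi; rewrite -!iterS !iterSr; apply: h4.
Qed.

Lemma runs_enumerates (R S : relation) ans t1 cf1 t2 cf2 pre d delay :
  runs P (init_config R S) t1 cf1 -> t1 = nseq (size t1) None -> size t1 <= pre ->
  nth IHalt P cf1.1 = IEndPre -> runs P (cf1.1.+1, cf1.2) t2 cf2 ->
  nth IHalt P cf2.1 = IHalt -> uniq (outs t2) -> perm_eq (outs t2) ans ->
  ontime d (None :: t2) -> d < delay -> enumerates P R S ans pre delay.
Proof.
set cf0 := init_config R S.
move=> /runs_nth[n1 i1] q1 s1 e1 /runs_nth[n2 i2] e2 u p ot dd.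
have st1 : step P cf1 = (cf1.1.+1, cf1.2) by case: (cf1) e1 => pc m /= ->.
have at1 : conf_at P cf0 (size t1) = cf1 by [].
have at2 i : conf_at P cf0 ((size t1).+1 + i) = iter i (step P) (cf1.1.+1, cf1.2).
  by rewrite /conf_at addnC iterD iterS i1 st1.
have halt t : halted_at P cf0 t = is_halt (cur_instr P (conf_at P cf0 t)) by [].
have h1 : cur_instr P cf1 = IEndPre by [].
have obs2 i : i <= size t2 -> out_at P cf0 (size t1 + i) = nth None (None :: t2) i.
  case: i => [|i] hi; first by rewrite addn0 /out_at at1 h1.
  have [_ _] := n2 _ hi; rewrite -at2 -addSnnS => E.
  by rewrite -[LHS]/(obs P (conf_at P cf0 _)) E.
(* [IEndPre] is reached at time [size t1] and takes one step; [size t2] further steps lead to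
   [IHalt]. *)
exists (size t1), ((size t1).+1 + size t2); split.
- by split=> //; rewrite /endpre_at at1 h1.
- move=> t ht; have [a b c] := n1 _ ht; split=> //.
  by rewrite -[LHS]/(obs P (iter t (step P) cf0)) c q1 nth_nseq ht.
- split; first by rewrite addSn leqW ?leq_addr.
    by rewrite halt at2 i2 /cur_instr e2.
  move=> t; rewrite halt; case: (ltngtP t (size t1)) => [/n1[]//|h|->] ht; last by rewrite at1 h1.
  have := n2 (t - (size t1).+1); rewrite -at2 subnKC // => -[] //.
  by rewrite ltn_subLR.
- have -> : (size t1).+1 + size t2 - size t1 = (size t2).+1 by rewrite addSnnS addKn.
  have -> : pmap (out_at P cf0) (iota (size t1) (size t2).+1) = outs t2.
    rewrite -[size t1]addn0 iotaDl -[outs t2]/(outs (None :: t2)).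
    have -> : None :: t2 = [seq nth None (None :: t2) i | i <- iota 0 (size t2).+1].
      by apply: (@eq_from_nth _ None) => [|i hi]; rewrite ?size_map ?size_iota // (nth_map 0) ?size_iota // nth_iota.
    have : {in iota 0 (size t2).+1, forall i, i <= size t2}.
      by move=> i; rewrite mem_iota.
    elim: (iota _ _) => // x l IH H /=; rewrite obs2 ?IH //; last first.
      by apply: H; rewrite inE eqxx.
    by move=> i il; apply: H; rewrite inE il orbT.
  by split.
- move=> t /andP[t1t tT].
  have [|i' [/andP[a b] c]] := @ontime_window d (None :: t2) (t - size t1) ot.
    by rewrite leq_subLR /= addnS -addSn.
  exists (size t1 + i'); split; first by move: t1t a b dd; lia.
  case/orP: c => [/eqP ->|c]; first by rewrite /= addnS eqxx.
  apply/orP; right; rewrite obs2 //.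
  by move: c; apply: contraR; rewrite -ltnNge => hi; rewrite nth_default.
Qed.
End Runs.

(** * Moving the input away from the registers *)

Definition save (v : nat) : seq instr := [:: IConst 2 (16 * v); IAdd 2 1 2; IStore 2 v].

(* The registers are the cells below 32, so the input stored there must move
   first. With [B := |S| + 32 (|R| + |S|)] in cell 1, cell 2 is parked at
   address [B], which makes it available for address computations. *)
Definition setup : seq instr :=
  nseq 32 (IAdd 1 1 0) ++ [:: IStore 1 2] ++ flatten [seq save v | v <- iota 3 29] ++
  [:: ILoad 3 1; IConst 2 32; IAdd 2 1 2; IStore 2 3].

(** All destinations are at least [m 1 >= 32], so no cell is overwritten before it has been
    saved. *)
Lemma saveP vs m : 32 <= m 1 -> all (fun v => 2 < v < 32) vs ->
  let m' := foldl mstep m (flatten [seq save v | v <- vs]) in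
  (forall x, x != 2 -> (forall v, v \in vs -> x != m 1 + 16 * v) -> m' x = m x) /\
  (forall v, v \in vs -> m' (m 1 + 16 * v) = m v).
Proof.
move=> m1 hvs m'; rewrite {}/m'; elim: vs m m1 hvs => [|v vs IH] m m1 //= /andP[hv hvs].
set m2 := upd _ _ _.
have E x : m2 x = if x == m 1 + 16 * v then m v else if x == 2 then m 1 + 16 * v else m x.
  rewrite /m2 /upd /=; have -> : (v == 2) = false by apply/eqP; lia.
  by case: (x == 2).
have E1 : m2 1 = m 1 by rewrite E ifN //; apply/eqP; lia.
have small x : x < 32 -> x != 2 -> m2 x = m x.
  by move=> x32 /negbTE x2; rewrite E x2 ifN //; apply/eqP; lia.
have [h1 h2] := IH m2 (ltac:(by rewrite E1)) hvs.
rewrite E1 in h1 h2; split=> [x x2 hx|x].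
  have xv : x != m 1 + 16 * v by apply: hx; rewrite inE eqxx.
  rewrite h1 // => [|w hw]; last by apply: hx; rewrite inE hw orbT.
  by rewrite E (negbTE xv) (negbTE x2).
rewrite inE; have [xvs _|xvs] := boolP (x \in vs).
  have := allP hvs x xvs => hx; rewrite h2 // small //; first lia.
  by apply/eqP; lia.
rewrite orbF => /eqP e; rewrite {}e in xvs *; rewrite h1 ?E ?eqxx //; first by apply/eqP; lia.
move=> w hw; apply: contraNneq xvs => e.
by have -> : v = w by lia.
Qed.

Lemma setupE : setup = nseq 32 (IAdd 1 1 0) ++ [:: IStore 1 2] ++
  flatten [seq save v | v <- iota 3 29] ++ [:: ILoad 3 1; IConst 2 32; IAdd 2 1 2; IStore 2 3].
Proof. by []. Qed.

Lemma foldl_cat4 (A B : Type) (f : A -> B -> A) z l1 l2 l3 l4 :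
  foldl f z (l1 ++ l2 ++ l3 ++ l4) = foldl f (foldl f (foldl f (foldl f z l1) l2) l3) l4.
Proof. by rewrite !foldl_cat. Qed.

(** Address [B], where cell 2 is parked, is entry 0 of array 0; the last four instructions bring the
    value to its proper place, entry 2 at [B + 32]. A copy of it stays in cell 3. *)
Lemma setup_mem m B : 32 <= B -> B = m 1 + 32 * m 0 ->
  let mB x := if x == B then m 2 else if x == 1 then B else m x in
  exists mC,
  [/\ forall x, foldl mstep m setup x =
        if x == B + 32 then m 2 else if x == 2 then B + 32 else if x == 3 then m 2 else mC x,
      forall x, x != 2 -> (forall v, 2 < v < 32 -> x != B + 16 * v) -> mC x = mB x
    & forall v, 2 < v < 32 -> mC (B + 16 * v) = mB v].
Proof.
move=> B32 EB mB; rewrite setupE foldl_cat4.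
have A x : foldl mstep m (nseq 32 (IAdd 1 1 0)) x = if x == 1 then B else m x.
  by rewrite add_loop // /upd EB.
move: (foldl mstep m _) A => mA A.
have EmB x : foldl mstep mA [:: IStore 1 2] x = mB x by rewrite /= /upd !A.
move: (foldl mstep mA _) EmB => m2 EmB.
have B1 : m2 1 = B by rewrite EmB /mB ifN //; apply/eqP; lia.
have B1' : 32 <= m2 1 by rewrite B1.
have all32 : all (fun v => 2 < v < 32) (iota 3 29) by [].
have [h1 h2] := saveP B1' all32; rewrite B1 in h1 h2.
move: (foldl mstep m2 _) h1 h2 => mC h1 h2.
have in32 v : (v \in iota 3 29) = (2 < v < 32) by rewrite mem_iota.
have far x : x != 2 -> (forall v, 2 < v < 32 -> x != B + 16 * v) -> mC x = mB x.
  by move=> x2 hx; rewrite h1 ?EmB // => v; rewrite in32; apply: hx.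
exists mC; split=> // [x|v hv]; last by rewrite h2 ?EmB ?in32.
have C1 : mC 1 = B by rewrite far // /mB ?ifN // => [|v _]; apply/eqP; lia.
have CB : mC B = m 2.
  by rewrite far /mB ?eqxx // => [|v hv]; apply/eqP; lia.
by rewrite /= /upd /= C1 CB; case: (x == 2).
Qed.

Lemma setupP inp (R S : relation) m :
  let N := size R + size S in let m' := foldl mstep m setup in
  0 < N -> m 0 = N -> m 1 = size S -> (forall v, 1 < v -> m v = inp v) ->
  (forall v, 2 * N + 2 <= v -> inp v = 0) ->
  let s := State m' (fun j v => m' (m' 1 + 16 * v + j)) in
  represents inp (2 * N + 2) s m' /\ loaded inp R S s.
Proof.
move=> N; have [B EB] : exists B, B = size S + 32 * N by exists (size S + 32 * N).
move: (foldl mstep m setup) (@setup_mem m B) => m' H m'' N0 m0 m1 mv iv.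
rewrite /m'' {m''}; have B32 : 32 <= B by lia.
(* As N > 0, the base lies beyond the registers and beyond the 2 N + 2 input cells. *)
have BN : 2 * N + 2 <= B by rewrite EB; lia.
have [|mC [E h1 h2]] := H B32; first by rewrite EB m0 m1.
rewrite (mv 2) // in E h1 h2; clear H.
pose mB x := if x == B then inp 2 else if x == 1 then B else m x.
have {}h1 : forall x, x != 2 -> (forall v, 2 < v < 32 -> x != B + 16 * v) -> mC x = mB x by [].
have {}h2 : forall v, 2 < v < 32 -> mC (B + 16 * v) = mB v by [].
have Bv x : mB x = if x == B then inp 2 else if x == 1 then B else m x by [].
clearbody mB.
have B1 : mB 1 = B by rewrite Bv ifN //; apply/eqP; lia.
have small x : x < B -> x != 2 -> x != 3 -> m' x = mB x.
  move=> xB x2 x3; rewrite E (negbTE x2) (negbTE x3) ifN; last by apply/eqP; lia.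
  by rewrite h1 // => v _; apply/eqP; lia.
have m'1 : m' 1 = B by rewrite small ?B1 //; lia.
have arE j v : j < 16 -> 1 < v < 32 \/ 0 < j -> m' (B + 16 * v + j) = if j == 0 then inp v else 0.
  move=> j16 hv; rewrite E; case: eqP => [e|ne].
    by move: e; rewrite -addnA => /addnI e; have [-> ->] : j = 0 /\ v = 2 by move: e j16; clear; lia.
  have [-> ->] : (B + 16 * v + j == 2) = false /\ (B + 16 * v + j == 3) = false by split; apply/eqP; lia.
  case: eqP => [e|/eqP j0]; first rewrite {}e in ne hv *.
    have {}hv : 2 < v < 32 by move: ne hv; lia.
    rewrite addn0 h2 // Bv !ifN ?mv //; try (by apply/eqP; lia); lia.
  rewrite h1; first by rewrite Bv !ifN ?mv ?iv //; try (by apply/eqP; lia); lia.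
    by apply/eqP; lia.
  by move=> w _; apply/eqP; lia.
split.
  split=> //; rewrite ?m'1 // => v hv.
  by rewrite small ?Bv ?ifN ?mv //; try (by apply/eqP; lia); lia.
split; rewrite /= ?m'1 //.
- by rewrite small ?Bv ?ifN //; try (by apply/eqP; lia); lia.
- by move=> v hv; have := arE 0 v isT (or_introl hv).
- by move=> j v /andP[j0 j16]; rewrite arE //; [rewrite ifN // -lt0n | right].
Qed.

(** * The program and its analysis *)

Definition finale : cmd := Seq work drain.

(** Replaces |R| by |D| in cell 0 and stops at once on the empty database, for which [B] would be 0
    and the arrays would overlap the registers. *)
Definition guard : seq instr := [:: IAdd 0 0 1; IJz 0 3; IJmp 5; IEndPre; IHalt].

Definition assemble (l : seq instr) (c1 c2 : cmd) : program :=
  l ++ compile (size l) c1 ++ IEndPre :: compile (size l + clen c1).+1 c2 ++ [:: IHalt].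

Lemma assemble_code l c1 c2 :
  let P := assemble l c1 c2 in
  [/\ code_at P 0 l, code_at P (size l) (compile (size l) c1),
      nth IHalt P (size l + clen c1) = IEndPre,
      code_at P (size l + clen c1).+1 (compile (size l + clen c1).+1 c2)
    & nth IHalt P ((size l + clen c1).+1 + clen c2) = IHalt].
Proof.
rewrite /assemble; split.
- exact: (code_at_mid [::]).
- exact: code_at_mid.
- have := code_at_mid (l ++ compile (size l) c1) [:: IEndPre] (compile (size l + clen c1).+1 c2 ++ [:: IHalt]).
  by rewrite size_cat size_compile -catA => -[].
- have := code_at_mid (l ++ compile (size l) c1 ++ [:: IEndPre]) (compile (size l + clen c1).+1 c2) [:: IHalt].
  by rewrite !size_cat /= size_compile addn1 addnS -!catA.
- have := code_at_mid (l ++ compile (size l) c1 ++ IEndPre :: compile (size l + clen c1).+1 c2) [:: IHalt] [::].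
  have -> : size (l ++ compile (size l) c1 ++ IEndPre :: compile (size l + clen c1).+1 c2) =
      (size l + clen c1).+1 + clen c2 by rewrite !size_cat /= !size_compile; lia.
  by rewrite -!catA => -[].
Qed.

Definition enumerator : program := assemble (guard ++ setup) prep finale.

Lemma wf_prep : wf prep. Proof. by []. Qed.
Lemma silent_prep : silent prep. Proof. by []. Qed.
Lemma wf_finale : wf finale. Proof. by []. Qed.
Lemma size_setup : size setup = 124. Proof. by []. Qed.

Lemma enc_out (R S : relation) v : 2 * (size R + size S) + 2 <= v -> nth 0 (enc_flat R S) v = 0.
Proof.
move=> h; rewrite nth_default // /enc_flat; set L := flatten _.
suff -> : size [:: size R, size S & L] = 2 * (size R + size S) + 2 by [].
rewrite /L -size_cat /=; elim: (R ++ S) => //= t L' IH; lia.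
Qed.

(** Since [f <= j + 1], the inner quotient is at most 4 q + 3, so the left side is at most 4000 q +
    5050; this fits below 7000 (q + 1). *)
Lemma delay_bound m j f : f <= j.+1 ->
  1000 * (4 * m %/ j.+1 + 2) + 50 < 7 * 1000 * (m %/ maxn 1 f).+1.
Proof.
move=> fj; set q := m %/ maxn 1 f.
have f0 : 0 < maxn 1 f by rewrite leq_max.
suff : 4 * m %/ j.+1 < 4 * q.+1 by lia.
rewrite ltn_divLR // -mulnA ltn_pmul2l //.
apply: (@leq_trans (q.+1 * maxn 1 f)); first by rewrite -ltn_divLR.
by rewrite leq_mul2l geq_max fj orbT.
Qed.

Lemma nones_cat (t1 t2 : trace) : t1 = nseq (size t1) None -> t2 = nseq (size t2) None ->
  t1 ++ t2 = nseq (size (t1 ++ t2)) None.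
Proof. by move=> h1 h2; rewrite size_cat nseqD -h1 -h2. Qed.

Theorem theorem1p1 :
  exists (P : program) (c : nat),
    forall R S : relation, uniq R -> uniq S ->
      enumerates P R S (two_path R S)
        (c * (db_size R S).+1)
        (c * ((db_size R S) ^ 2 %/ maxn 1 (size (full_join R S))).+1).
Proof.
exists enumerator, (7 * 1000) => R S uR uS; rewrite /db_size; set N := size R + size S.
have [code1 code2 end1 code3 halt] := assemble_code (guard ++ setup) prep finale.
rewrite -/enumerator in code1 code2 end1 code3 halt.
move: enumerator code1 code2 end1 code3 halt => P; rewrite size_cat size_setup.
move=> /code_at_cat[cg cs] code2 end1 code3 halt.
have /= [i0 [i1 [i2 [i3 [i4 _]]]]] := cg; clear cg.
pose m0 := (init_config R S).2; pose m1 := upd m0 0 N.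
have init0 : init_config R S = (0, m0) by [].
have s0 : step P (0, m0) = (1, m1) by rewrite /step i0.
have m00 : m0 0 = size R by []. have m01 : m0 1 = size S by [].
have obs0 t1 cf : runs P (1, m1) t1 cf -> runs P (init_config R S) (None :: t1) cf.
  by move=> h; rewrite init0 /=; split; rewrite ?/obs ?/cur_instr /= ?i0.
have [N00|N0] := posnP N.
  have [R0 S0] : R = [::] /\ S = [::].
    by move: N00; rewrite /N; case: (R) => [|a R']; case: (S) => [|b S'].
  (* On the empty database [guard] runs alone: two steps, then [IEndPre] and [IHalt]. *)
  apply: (@runs_enumerates P R S _ [:: None; None] (3, m1) [::] (4, m1) _ 2) => //.
  - apply: obs0; rewrite /= /obs /cur_instr /= i1; split=> //.
    by rewrite /m1 upd_eq N00.
  - by rewrite N00 muln1.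
  - by rewrite R0 S0.
  - by move=> [|[|n]].
  - by rewrite N00 div0n muln1.
have m10 : m1 0 = N by rewrite /m1 upd_eq.
have m11 : m1 1 = size S by [].
have mv v : 1 < v -> m1 v = nth 0 (enc_flat R S) v by case: v => // v _.
have [rl ld] := setupP N0 m10 m11 mv (@enc_out R S).
have plain_setup : all plain setup by [].
have run_setup := runs_plain m1 cs plain_setup; rewrite size_setup in run_setup.
set m2 := foldl mstep m1 setup in rl ld run_setup.
have [s1 [t1 [e1 sz1 [rd fr]]]] := prepP uR uS ld.
have [m3 run1 rl1] := runs_exec e1 wf_prep rl code2.
(* y* is the value left in [rYS]; its maximality gives both bounds on J required by [mainP]. *)
have star_max := ready_max rd; rewrite (ready_best rd) in star_max.
have JS := joinsize_sqr star_max; have JS2 := joinsize_star star_max.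
have [s2 [t2 [e2 [pe ot]]]] := mainP (nth 0 (enc_flat R S)) (2 * N + 2) uR uS N0 (joinsize_le R S) JS JS2 rd erefl fr.
have [m4 run2 rl2] := runs_exec e2 wf_finale rl1 code3.
have start : runs P (1, m1) (nseq 2 None) (5, m1).
  rewrite /= /obs /cur_instr /= i1 m10; split=> //.
  have -> : (N == 0) = false by apply/eqP; lia.
  by rewrite /= i2; split.
have run0 := obs0 _ _ (runs_cat start (runs_cat run_setup run1)).
apply: (runs_enumerates run0 _ _ end1 run2 halt _ pe ot).
- rewrite -cat1s; apply: nones_cat => //; apply: nones_cat; first by rewrite size_nseq.
  by apply: nones_cat; [rewrite size_nseq | apply: exec_silent e1 silent_prep].
- rewrite -cat1s !size_cat !size_nseq; have -> : size [:: @None (nat * nat)] = 1 by [].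
  by move: sz1; lia.
- by rewrite (perm_uniq pe) undup_uniq.
- apply: delay_bound; apply: leqW; exact: full_join_le.
Qed.
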